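(* Let $N$ be a simply connected two-step nilpotent Lie group of dimension five, equipped with a left invariant Riemannian metric $g$. Then the scalar curvature of the Riemannian manifold $(N,g)$ is a negative constant.
   Context: A Riemannian metric $g$ on a Lie group $N$ is left invariant if all left translations of $N$ are isometries of $g$. A Lie group is two-step nilpotent if its Lie algebra $\mathfrak{n}$ is non-abelian and satisfies $[\mathfrak{n},[\mathfrak{n},\mathfrak{n}]]=0$. *)

(* Defs.v *)
From HB Require Import structures.
From mathcomp Require Import all_boot all_order all_algebra.
From mathcomp Require Import all_classical all_reals all_analysis.
Import Order.TTheory GRing.Theory Num.Theory.
Import numFieldNormedType.Exports.

Set Implicit Arguments.
Unset Strict Implicit.
Unset Printing Implicit Defensive.

Local Open Scope classical_set_scope.
Local Open Scope ring_scope.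

Fixpoint times_differentiable (R : realType) (V W : normedModType R) (k : nat)
    (U : set V) (f : V -> W) : Prop :=
  if k is k'.+1 then
    (forall x, U x -> differentiable f x) /\
    (forall v, times_differentiable k' U ('D_v f))
  else True.

(* C^oo on the open set U; continuity of each iterated derivative is implied
   by its differentiability. *)
Definition smooth_on (R : realType) (V W : normedModType R)
    (U : set V) (f : V -> W) : Prop :=
  forall k, times_differentiable k U f.

(* Both maps of a chart are total; their values outside dom and cod are
   irrelevant. *)
Record chart (R : realType) (n : nat) (M : topologicalType) := Chart {
  chart_dom : set M ;
  chart_cod : set 'rV[R]_n ;
  chart_to :> M -> 'rV[R]_n ;
  chart_inv : 'rV[R]_n -> M ;
  chart_open_dom : open chart_dom ;
  chart_open_cod : open chart_cod ;
  chart_to_cod : forall p, chart_dom p -> chart_cod (chart_to p) ;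
  chart_inv_dom : forall x, chart_cod x -> chart_dom (chart_inv x) ;
  chart_toK : forall p, chart_dom p -> chart_inv (chart_to p) = p ;
  chart_invK : forall x, chart_cod x -> chart_to (chart_inv x) = x ;
  chart_to_continuous : {in chart_dom, continuous chart_to} ;
  chart_inv_continuous : {in chart_cod, continuous chart_inv}
}.

(* A smooth manifold structure on M.  The preferred chart chart_at p serves to
   model the tangent space at p on 'rV[R]_n: the vector v of 'rV[R]_n stands
   for the tangent vector at p with components v in the chart chart_at p. *)
Record smoothStructure (R : realType) (n : nat) (M : topologicalType) :=
  SmoothStructure {
  atlas : set (chart R n M) ;
  chart_at : M -> chart R n M ;
  chart_at_atlas : forall p, atlas (chart_at p) ;
  chart_at_dom : forall p, chart_dom (chart_at p) p ;
  atlas_compatible : forall c d, atlas c -> atlas d ->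
    smooth_on (chart_cod c `&` chart_inv c @^-1` chart_dom d)
              (d \o chart_inv c) ;
  manifold_hausdorff : hausdorff_space M ;
  manifold_second_countable : @second_countable M
}.

Definition smooth_fun (R : realType) (n : nat) (M : topologicalType)
    (A : smoothStructure R n M) (U : set M) (f : M -> R) : Prop :=
  forall c, atlas A c ->
    smooth_on (chart_cod c `&` chart_inv c @^-1` U) (f \o chart_inv c).

Definition deriv_along (R : realType) (n : nat) (M : topologicalType)
    (A : smoothStructure R n M) (f : M -> R) (p : M) (v : 'rV[R]_n) : R :=
  'd (f \o chart_inv (chart_at A p)) (chart_at A p p) v.

(* The differential T_p M -> T_(F p) M of a map F. *)
Definition tangent_map (R : realType) (n : nat) (M : topologicalType)
    (A : smoothStructure R n M) (F : M -> M) (p : M) (v : 'rV[R]_n) :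
    'rV[R]_n :=
  'd (chart_at A (F p) \o F \o chart_inv (chart_at A p)) (chart_at A p p) v.

(* X p is an element of the tangent space at p. *)
Definition vfield (R : realType) (n : nat) (M : topologicalType)
    (A : smoothStructure R n M) := M -> 'rV[R]_n.

Section VectorFields.
Context (R : realType) (n : nat) (M : topologicalType)
  (A : smoothStructure R n M).
Implicit Types (X Y Z : vfield A) (f : M -> R).

Definition lie_deriv X f : M -> R := fun p => deriv_along A f p (X p).

Definition smooth_vfield (U : set M) X : Prop :=
  forall V f, open V -> V `<=` U -> smooth_fun A V f ->
    smooth_fun A V (lie_deriv X f).

(* [X, Y] f = X (Y f) - Y (X f); the components in the chart at p are obtained
   by taking for f the coordinate functions of that chart. *)
Definition lie_bracket X Y : vfield A := fun p =>
  \row_(i < n) (lie_deriv X (lie_deriv Y (fun q => chart_at A p q 0 i)) p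
              - lie_deriv Y (lie_deriv X (fun q => chart_at A p q 0 i)) p).

Definition vfield_add X Y : vfield A := fun p => X p + Y p.
Definition vfield_sub X Y : vfield A := fun p => X p - Y p.
Definition vfield_scale f X : vfield A := fun p => f p *: X p.

Record riemannianMetric := RiemannianMetric {
  metric_at :> M -> 'rV[R]_n -> 'rV[R]_n -> R ;
  metric_linear : forall p a u v w,
    metric_at p (a *: u + v) w = a * metric_at p u w + metric_at p v w ;
  metric_sym : forall p u v, metric_at p u v = metric_at p v u ;
  metric_pos : forall p u, u != 0 -> 0 < metric_at p u u ;
  metric_smooth : forall U X Y, open U ->
    smooth_vfield U X -> smooth_vfield U Y ->
    smooth_fun A U (fun p => metric_at p (X p) (Y p))
}.

(* nabla X Y is the covariant derivative of Y along X; only its values on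
   smooth vector fields are meaningful. *)
Record levi_civita (g : riemannianMetric)
    (nabla : vfield A -> vfield A -> vfield A) : Prop := LeviCivita {
  nabla_smooth : forall X Y, smooth_vfield setT X -> smooth_vfield setT Y ->
    smooth_vfield setT (nabla X Y) ;
  nabla_addl : forall X Y Z, smooth_vfield setT X -> smooth_vfield setT Y ->
    smooth_vfield setT Z ->
    nabla (vfield_add X Y) Z = vfield_add (nabla X Z) (nabla Y Z) ;
  nabla_scalel : forall f X Y, smooth_fun A setT f ->
    smooth_vfield setT X -> smooth_vfield setT Y ->
    nabla (vfield_scale f X) Y = vfield_scale f (nabla X Y) ;
  nabla_addr : forall X Y Z, smooth_vfield setT X -> smooth_vfield setT Y ->
    smooth_vfield setT Z ->
    nabla X (vfield_add Y Z) = vfield_add (nabla X Y) (nabla X Z) ;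
  nabla_leibniz : forall f X Y, smooth_fun A setT f ->
    smooth_vfield setT X -> smooth_vfield setT Y ->
    nabla X (vfield_scale f Y) =
    vfield_add (vfield_scale (lie_deriv X f) Y) (vfield_scale f (nabla X Y)) ;
  nabla_torsion_free : forall X Y,
    smooth_vfield setT X -> smooth_vfield setT Y ->
    vfield_sub (nabla X Y) (nabla Y X) = lie_bracket X Y ;
  nabla_metric : forall X Y Z, smooth_vfield setT X -> smooth_vfield setT Y ->
    smooth_vfield setT Z -> forall p,
    lie_deriv X (fun q => g q (Y q) (Z q)) p =
    g p (nabla X Y p) (Z p) + g p (Y p) (nabla X Z p)
}.

Definition curvature (nabla : vfield A -> vfield A -> vfield A) X Y Z :
    vfield A :=
  vfield_sub (vfield_sub (nabla X (nabla Y Z)) (nabla Y (nabla X Z)))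
             (nabla (lie_bracket X Y) Z).

Definition is_scalar_curvature (g : riemannianMetric) (p : M) (s : R) : Prop :=
  exists (nabla : vfield A -> vfield A -> vfield A) (E : 'I_n -> vfield A),
  [/\ levi_civita g nabla,
      (forall i, smooth_vfield setT (E i)),
      (forall i j, g p (E i p) (E j p) = (i == j)%:R) &
      s = \sum_(i < n) \sum_(j < n)
            g p (curvature nabla (E i) (E j) (E j) p) (E i p)].

(* The trace of the Ricci tensor.  The number s of is_scalar_curvature exists
   and is unique: the Levi-Civita connection exists and is unique on smooth
   fields, curvature is a tensor, and every orthonormal basis of the tangent
   space at p extends to smooth vector fields.  The default value 0 is thus
   never used. *)
Definition scalar_curvature (g : riemannianMetric) (p : M) : R :=
  xget 0 [set s | is_scalar_curvature g p s].

End VectorFields.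

Definition simply_connected (R : realType) (M : topologicalType) : Prop :=
  let I := `[0, 1]%classic : set R in
  (forall p q : M, exists gamma : R -> M,
     [/\ {within I, continuous gamma}, gamma 0 = p & gamma 1 = q]) /\
  (forall gamma : R -> M, {within I, continuous gamma} -> gamma 0 = gamma 1 ->
     exists H : R * R -> M,
     [/\ {within I `*` I, continuous H},
         forall t, I t -> H (0, t) = gamma t,
         forall t, I t -> H (1, t) = gamma 0 &
         forall s, I s -> H (s, 0) = gamma 0 /\ H (s, 1) = gamma 0]).

Local Open Scope group_scope.

HB.mixin Record isTopologicalGroup G & Topological G & Group G := {
  mulg_continuous : continuous (fun x : G * G => x.1 * x.2) ;
  invg_continuous : continuous (fun x : G => x^-1)
}.

#[short(type="topologicalGroupType")]
HB.structure Definition TopologicalGroup :=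
  {G of Topological G & Group G & isTopologicalGroup G}.

Section LieGroups.
Context (R : realType) (n : nat) (N : topologicalGroupType).
Implicit Types (A : smoothStructure R n N).

Definition lie_group A : Prop :=
  (forall a b c, atlas A a -> atlas A b -> atlas A c ->
     smooth_on [set x : 'rV[R]_n * 'rV[R]_n |
                 [/\ chart_cod a x.1, chart_cod b x.2 &
                     chart_dom c (chart_inv a x.1 * chart_inv b x.2)]]
               (fun x => c (chart_inv a x.1 * chart_inv b x.2))) /\
  (forall a c, atlas A a -> atlas A c ->
     smooth_on [set x | chart_cod a x /\ chart_dom c (chart_inv a x)^-1]
               (fun x => c (chart_inv a x)^-1)).

(* The Lie algebra: smooth left invariant vector fields with lie_bracket. *)
Definition lie_algebra A : set (vfield A) :=
  [set X | smooth_vfield setT X /\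
     forall a p : N, X (a * p) = tangent_map A (fun q => a * q) p (X p)].

Definition two_step_nilpotent A : Prop :=
  (exists X Y, [/\ lie_algebra X, lie_algebra Y &
     lie_bracket X Y <> (fun=> 0%R : 'rV[R]_n) :> vfield A]) /\
  (forall X Y Z : vfield A, lie_algebra X -> lie_algebra Y -> lie_algebra Z ->
     lie_bracket X (lie_bracket Y Z) = (fun=> 0%R)).

Definition left_invariant_metric A (g : riemannianMetric A) : Prop :=
  forall (a p : N) (u v : 'rV[R]_n),
    g (a * p) (tangent_map A (fun q => a * q) p u)
              (tangent_map A (fun q => a * q) p v) = g p u v.

End LieGroups.

(* Main.v *)
Require Import Defs.
From mathcomp Require Import all_boot all_order all_algebra.
From mathcomp Require Import all_classical all_reals all_analysis.
From mathcomp Require Import ring lra.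
Import Order.TTheory GRing.Theory Num.Theory.
Import numFieldNormedType.Exports.

Set Implicit Arguments.
Unset Strict Implicit.
Unset Printing Implicit Defensive.

Local Open Scope classical_set_scope.
Local Open Scope ring_scope.

(** Let E_1, .., E_n be a left invariant orthonormal frame and
    c_ijk = <[E_i, E_j], E_k>.  Brackets of left invariant fields are left
    invariant and left translations are isometries, so the c_ijk are constants
    and everything reduces to algebra with them.

    In the frame the Levi-Civita connection is explicit: with
    Gamma_ijk = (c_ijk - c_jki + c_kij) / 2, the k-th coordinate of nabla_X Y is
    X(y_k) + sum_ij x_i y_j Gamma_ijk.  This formula defines a Levi-Civita
    connection ([frame_nabla_levi_civita]), and the Koszul formula says that
    there is no other on smooth fields ([levi_civita_unique]).  Its curvature
    at p is a trilinear expression in the coordinates of the three fields at p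
    ([frame_coord_curvature]); hence the trace that defines the scalar
    curvature has the same value for every orthonormal basis and every point
    ([frame_scalar_curvature]), namely
      - 1/4 sum_ijk c_ijk^2 - 1/2 sum_i tr (ad E_i)^2 - sum_i (tr ad E_i)^2
    ([scalar_of_structE]).  In a two-step nilpotent algebra (ad E_i)^2 = 0, so
    the value is at most - 1/4 sum_ijk c_ijk^2, which is negative because some
    bracket is nonzero ([scalar_of_struct_lt0]).

    The analysis behind this is the identity [X, Y] f = X (Y f) - Y (X f) for
    all smooth functions f ([lie_bracketE]), which rests on the symmetry of
    second derivatives ([derive_comm]), and the smoothness of left invariant
    fields ([smooth_invariant_field]), obtained by differentiating the
    multiplication in its second argument.  Smooth functions are handled by
    germs ([smooth_near]), so that every rule of calculus becomes a pointwise
    statement without reference to domains. *)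

(** * Calculus of repeatedly differentiable maps *)

Section DifferentiableGerm.
Context (R : realType) (V W : normedModType R).
Implicit Types (f g : V -> W) (x v : V).

(** Differentiability and the differential depend only on the germ: the little-o
    expansion of f at x is also one of g, and the differential is unique. *)
Lemma near_eq_diff f g x : differentiable f x -> {near x, f =1 g} ->
  differentiable g x /\ 'd g x = 'd f x :> (V -> W).
Proof.
move=> df fg.
have Eg : g \o shift x = cst (g x) + 'd f x +o_ (0 : V) id.
  apply/eqaddoP => e e0.
  have /eqaddoP/(_ _ e0) := diff_locally df.
  have fg' : \forall h \near (0 : V), f (h + x) = g (h + x).
    have cx : (h + x) @[h --> (0 : V)] --> x.
      by rewrite -[X in _ --> X]add0r; apply: cvgD; [exact: cvg_id|exact: cvg_cst].
    exact: cx fg.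
  rewrite !near_simpl => fe; near=> h.
  have -> : (g \o shift x - (cst (g x) + 'd f x)) h =
            (f \o shift x - (cst (f x) + 'd f x)) h.
    rewrite !fctE /= (nbhs_singleton fg); congr (_ - _); apply/esym.
    by near: h.
  by near: h.
have E : 'd g x = 'd f x :> (V -> W).
  by apply: diff_unique Eg; exact: diff_continuous.
by split=> //; apply/diff_locallyP; rewrite E; split => //; exact: diff_continuous.
Unshelve. all: by end_near. Qed.
End DifferentiableGerm.

Section TimesDifferentiable.
Context (R : realType).
Implicit Types (V W : normedModType R) (k : nat).

Lemma times_differentiable_sub V W k (U U' : set V) (f : V -> W) :
  U' `<=` U -> times_differentiable k U f -> times_differentiable k U' f.
Proof.
move=> UU; elim: k f => //= k IH f [df Df]; split=> [x /UU|v]; first exact: df.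
exact: IH.
Qed.

Lemma times_differentiable_eq V W k (U : set V) (f g : V -> W) :
  open U -> {in U, f =1 g} ->
  times_differentiable k U f -> times_differentiable k U g.
Proof.
move=> oU; elim: k f g => //= k IH f g fg [df Df].
have nfg x : U x -> {near x, f =1 g}.
  move=> Ux; have := open_nbhs_nbhs (conj oU Ux).
  by apply: filterS => y Uy; apply: fg; rewrite inE.
split=> [x Ux|v]; first by have [] := near_eq_diff (df x Ux) (nfg x Ux).
apply: IH (Df v) => x; rewrite inE => Ux.
exact: near_eq_derive (nfg x Ux).
Qed.

Lemma times_differentiable_local V W k (U : set V) (f : V -> W) :
  (forall x, U x -> exists2 U', U' x & times_differentiable k U' f) ->
  times_differentiable k U f.
Proof.
elim: k f => //= k IH f loc; split=> [x /loc[U' U'x [df _]]|v]; first exact: df.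
by apply: IH => x /loc[U' U'x [_ Df]]; exists U'.
Qed.

Lemma times_differentiableS V W k (U : set V) (f : V -> W) :
  times_differentiable k.+1 U f -> times_differentiable k U f.
Proof.
elim: k f => // k IH f [df Df]; split=> [//|v].
exact/IH/Df.
Qed.

Lemma times_differentiable_cst V W k (U : set V) (a : W) :
  times_differentiable k U (cst a).
Proof.
elim: k a => //= k IH a; split=> [x _|v]; first exact: differentiable_cst.
rewrite (_ : derive _ ^~ v = cst 0); first exact: IH.
by apply/funext => x; rewrite derive_cst.
Qed.

Lemma times_differentiableD V W k (U : set V) (f g : V -> W) : open U ->
  times_differentiable k U f -> times_differentiable k U g ->
  times_differentiable k U (f \+ g).
Proof.
move=> oU; elim: k f g => //= k IH f g [df Df] [dg Dg]; split=> [x Ux|v].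
  by apply: differentiableD; [exact: df|exact: dg].
apply: times_differentiable_eq oU _ (IH _ _ (Df v) (Dg v)) => x.
rewrite inE => Ux; rewrite /= (_ : f \+ g = f + g) // deriveD //; apply: diff_derivable.
  exact: df.
exact: dg.
Qed.

Lemma times_differentiable_sum V W k (U : set V) (I : Type) (r : seq I)
    (f : I -> V -> W) : open U ->
  (forall i, times_differentiable k U (f i)) ->
  times_differentiable k U (fun x => \sum_(i <- r) f i x).
Proof.
move=> oU df; elim: r => [|i r IH].
  rewrite (_ : (fun _ => _) = cst 0); first exact: times_differentiable_cst.
  by apply/funext => x; rewrite big_nil.
rewrite (_ : (fun _ => _) = f i \+ (fun x => \sum_(i <- r) f i x)).
  exact: times_differentiableD.
by apply/funext => x; rewrite big_cons.
Qed.

Lemma times_differentiableM V k (U : set V) (f g : V -> R) : open U ->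
  times_differentiable k U f -> times_differentiable k U g ->
  times_differentiable k U (f \* g).
Proof.
move=> oU; elim: k f g => [//|k IH] f g Df Dg.
have [[df D1f] [dg D1g]] := (Df, Dg); split=> [x Ux|v].
  by apply: differentiableM; [exact: df|exact: dg].
have Hf := times_differentiableS Df; have Hg := times_differentiableS Dg.
apply: times_differentiable_eq oU _
  (times_differentiableD oU (IH _ _ Hf (D1g v)) (IH _ _ Hg (D1f v))) => x.
rewrite inE => Ux; rewrite /= (_ : f \* g = f * g) // deriveM //; apply: diff_derivable.
  exact: df.
exact: dg.
Qed.

Lemma times_differentiable_coord V n k (U : set V) (f : V -> 'rV[R]_n) i :
  open U -> times_differentiable k U f ->
  times_differentiable k U (fun x => f x 0 i).
Proof.
move=> oU; elim: k f => //= k IH f [df Df]; split=> [x Ux|v].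
  apply: (@differentiable_comp _ _ _ _ f (fun M : 'rV[R]_n => M 0 i)).
    exact: df.
  exact: differentiable_coord.
apply: times_differentiable_eq oU _ (IH _ (Df v)) => x.
rewrite inE => Ux; rewrite derive_mx ?mxE //.
by apply: diff_derivable; apply: df.
Qed.

(** Affine precomposition needs no chain rule with partial derivatives: the
    derivative of f o s along v is D_(L v) f o s.  It serves for the partial maps
    of a function of two variables. *)
Lemma times_differentiable_affine V V' W k (U : set V) (f : V -> W)
    (s L : V' -> V) :
  (forall x, is_diff x s L) -> open U -> times_differentiable k U f ->
  times_differentiable k (s @^-1` U) (f \o s).
Proof.
move=> ds oU.
have oU' : open (s @^-1` U).
  apply: open_comp oU => x _; apply: differentiable_continuous.
  by have [] := ds x.
elim: k f => //= k IH f [df Df]; split=> [x Ux|v].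
  by apply: differentiable_comp; [have [] := ds x|exact: df].
apply: times_differentiable_eq oU' _ (IH _ (Df (L v))) => x.
rewrite inE => Ux; have [dsx sL] := ds x.
have dfx := df _ Ux.
rewrite /= [RHS]deriveE; last exact: differentiable_comp.
by rewrite diff_comp // deriveE //= sL.
Qed.

Lemma diff_partial W n (f : 'rV[R]_n -> W) x v : differentiable f x ->
  'd f x v = \sum_i v 0 i *: 'D_(delta_mx 0 i) f x.
Proof.
move=> df; rewrite {1}(row_sum_delta v) linear_sum; apply: eq_bigr => i _.
by rewrite linearZ deriveE.
Qed.

(** The iterated derivatives are directional, so the chain rule is expanded in
    the standard basis of the intermediate space to make the induction go
    through: D_v (g o f) = sum_i (D_v f)_i * (D_(e_i) g o f). *)
Lemma times_differentiable_comp V n k (U : set V) (U' : set 'rV[R]_n)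
    (f : V -> 'rV[R]_n) (g : 'rV[R]_n -> R) :
  open U -> (forall x, U x -> U' (f x)) ->
  times_differentiable k U f -> times_differentiable k U' g ->
  times_differentiable k U (g \o f).
Proof.
move=> oU fU; elim: k g => [//|k IH] g Df Dg.
have [[df D1f] [dg D1g]] := (Df, Dg); split=> [x Ux|v].
  by apply: differentiable_comp; [exact: df|exact/dg/fU].
have Hf := times_differentiableS Df.
apply: (@times_differentiable_eq _ _ _ _
  (fun x => \sum_i ('D_v f x 0 i * 'D_(delta_mx 0 i) g (f x)))) => //; last first.
  apply: times_differentiable_sum => // i; apply: times_differentiableM => //.
    by apply: times_differentiable_coord => //; exact: D1f.
  exact: (IH _ Hf (D1g (delta_mx 0 i))).
move=> x; rewrite inE => Ux; have dfx := df x Ux; have dgx := dg _ (fU _ Ux).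
rewrite /= [RHS]deriveE; last exact: differentiable_comp.
by rewrite diff_comp //= (diff_partial _ dgx) -deriveE.
Qed.
End TimesDifferentiable.

(** * Symmetry of second derivatives *)

Section SymmetryOfSecondDerivatives.
Context (R : realType) (V : normedModType R).
Implicit Types (f : V -> R) (x v w : V).

Lemma is_derive_line f a w (t : R) : differentiable f (t *: w + a) ->
  is_derive t 1 (fun s => f (s *: w + a)) ('D_w f (t *: w + a)).
Proof.
move=> df.
have dl : is_diff t (fun s : R => s *: w + a) ( *:%R^~ w).
  have := is_diffD (is_diff_scalel t w) (is_diff_cst a t).
  by move=> [d1 d2]; split => //; rewrite d2; apply/funext => y; rewrite !fctE addr0.
have [dl1 dl2] := dl.
have dc : differentiable (f \o (fun s => s *: w + a)) t.
  exact: differentiable_comp.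
split; first exact: diff_derivable.
by rewrite [LHS](deriveE _ dc) diff_comp //= dl2 scale1r deriveE.
Qed.

Definition second_difference f x v w : R :=
  f (w + (v + x)) - f (w + x) - f (v + x) + f x.

Lemma second_difference_sym f x v w :
  second_difference f x v w = second_difference f x w v.
Proof. by rewrite /second_difference !addrA [w + v]addrC; ring. Qed.

(** The mean value theorem applied to t |-> f (x + h v + t w) - f (x + t w)
    turns the second difference into h times a difference of values of D_w f at
    points within O(h) of x; differentiability of D_w f at x evaluates it. *)
Lemma second_difference_le f (U : set V) x v w (e : R) : open U -> U x ->
  (forall y, U y -> differentiable f y) -> differentiable ('D_w f) x -> 0 < e ->
  exists2 d : R, 0 < d & forall h : R, 0 < h -> h < d ->
    `|second_difference f x (h *: v) (h *: w) - h ^+ 2 * 'D_v ('D_w f) x|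
      <= e * h ^+ 2.
Proof.
move=> oU Ux df dDf e0; rewrite deriveE //.
set L := 'd ('D_w f) x.
(* m h bounds |c w + h v| + |c w| for c in [0, h]; the 1 makes m positive. *)
pose m := `|v| + `|w| + `|w| + 1.
have m0 : 0 < m by rewrite ltr_wpDl // !addr_ge0.
have /eqaddoP/(_ (e / m)) := diff_locally dDf.
rewrite divr_gt0 // => /(_ isT); rewrite near_simpl.
move=> /nbhs_norm0P[d1 /= d10 Hd1].
have /nbhs_norm0P[d2 /= d20 Hd2] : \forall y \near (0 : V), U (y + x).
  have cx : (y + x) @[y --> (0 : V)] --> x.
    by rewrite -[X in _ --> X]add0r; apply: cvgD; [exact: cvg_id|exact: cvg_cst].
  by apply: cx; exact: open_nbhs_nbhs.
exists (Num.min d1 d2 / m); first by rewrite divr_gt0 // lt_min d10.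
move=> h h0; rewrite ltr_pdivlMr // lt_min => /andP[hd1 hd2].
have small (s t : R) : `|s| <= h -> `|t| <= h ->
    `|s *: w + t *: v| <= h * (m - 1 - `|w|).
  move=> sh th; rewrite (le_trans (ler_normD _ _)) // !normrZ.
  rewrite (_ : m - 1 - `|w| = `|w| + `|v|); last by rewrite /m; ring.
  by rewrite mulrDr lerD // ler_wpM2r.
have hm : h * (m - 1 - `|w|) <= h * m.
  by apply: ler_wpM2l; [exact: ltW|have := normr_ge0 w; lra].
pose phi (t : R) : R := f (t *: w + (h *: v + x)) - f (t *: w + x).
have Uin (s t : R) : `|s| <= h -> `|t| <= h -> U (s *: w + t *: v + x).
  by move=> sh th; apply: Hd2;
    rewrite /= (le_lt_trans (small _ _ sh th)) // (le_lt_trans hm).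
pose dphi (t : R) : R := 'D_w f (t *: w + (h *: v + x)) - 'D_w f (t *: w + x).
have phiD (t : R) : t \in `[0, h] -> is_derive t 1 phi (dphi t).
  rewrite in_itv /= => /andP[t0 th].
  have nt : `|t| <= h by rewrite ger0_norm.
  apply: is_deriveB; apply: is_derive_line; apply: df.
    by rewrite addrA; apply: Uin => //; rewrite ger0_norm // ltW.
  by have := Uin t 0; rewrite scale0r addr0 normr0; apply => //; rewrite ltW.
have phiD' (t : R) : t \in `]0, h[ -> is_derive t 1 phi (dphi t).
  by move=> th; apply: phiD; exact: subset_itv_oo_cc.
have cphi : {within `[0, h], continuous phi}.
  by apply: derivable_within_continuous => t /phiD[].
have [c] := MVT_segment (ltW h0) phiD' cphi.
rewrite in_itv /= => /andP[c0 ch]; rewrite subr0 /dphi addrA => phiE.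
have -> : second_difference f x (h *: v) (h *: w) = phi h - phi 0.
  by rewrite /second_difference /phi scale0r !add0r; ring.
rewrite {}phiE.
have nc : `|c| <= h by rewrite ger0_norm.
have nh : `|h| <= h by rewrite ger0_norm // ltW.
have nz : `|0 : R| <= h by rewrite normr0 ltW.
have LE (t : R) : L (c *: w + t *: v) = L (c *: w) + t * L v.
  by rewrite addrC linearP addrC.
have := Hd1 (c *: w + h *: v);
  rewrite /= (le_lt_trans (small _ _ nc nh)) ?(le_lt_trans hm) // => /(_ isT).
rewrite !fctE /= -/L LE => H1.
have := Hd1 (c *: w + 0 *: v);
  rewrite /= (le_lt_trans (small _ _ nc nz)) ?(le_lt_trans hm) // => /(_ isT).
rewrite !fctE /= -/L LE scale0r addr0 mul0r addr0 => H2.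
move: H1 H2.
set a := 'D_w f (_ + _ + x); set b := 'D_w f (_ + x); set z := 'D_w f x.
move=> H1 H2.
have -> : (a - b) * h - h ^+ 2 * L v =
   ((a - (z + (L (c *: w) + h * L v))) - (b - (z + L (c *: w)))) * h.
  by ring.
rewrite normrM (ger0_norm (ltW h0)) expr2 mulrA ler_wpM2r ?(ltW h0) //.
rewrite (le_trans (ler_normB _ _)) // (le_trans (lerD H1 H2)) // -mulrDr.
rewrite mulrAC ler_pdivrMr // -mulrA ler_wpM2l ?(ltW e0) // mulrC.
have A1 := small _ _ nc nh; have A2 : `|c *: w| <= h * `|w|.
  by rewrite normrZ ler_wpM2r.
rewrite mulrC (le_trans (lerD A1 A2)) // -mulrDr ler_wpM2l ?(ltW h0) //.
by rewrite subrK gerBl.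
Qed.

(** The second difference is symmetric in v and w and determines both iterated
    derivatives in the limit. *)
Lemma derive_comm f (U : set V) x v w : open U -> U x ->
  (forall y, U y -> differentiable f y) ->
  differentiable ('D_v f) x -> differentiable ('D_w f) x ->
  'D_v ('D_w f) x = 'D_w ('D_v f) x.
Proof.
move=> oU Ux df dv dw; apply/eqP; rewrite -subr_eq0 -normr_le0.
apply/ler_addgt0Pr => e e0; rewrite add0r.
have e20 : 0 < e / 2 by rewrite divr_gt0.
have [d1 d10 H1] := second_difference_le v oU Ux df dw e20.
have [d2 d20 H2] := second_difference_le w oU Ux df dv e20.
pose h := Num.min d1 d2 / 2.
have h0 : 0 < h by rewrite divr_gt0 // lt_min d10.
have hd : h < Num.min d1 d2 by rewrite /h ltr_pdivrMr // ltr_pMr ?ltr1n // lt_min d10.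
move: hd; rewrite lt_min => /andP[hd1 hd2].
have := H1 h h0 hd1; have := H2 h h0 hd2.
rewrite second_difference_sym; set A := second_difference _ _ _ _.
set p := 'D_v _ x; set q := 'D_w _ x => K2 K1.
have h20 : 0 < h ^+ 2 by rewrite exprn_gt0.
rewrite -(ler_pM2r h20) -[X in _ * X <= _](gtr0_norm h20) -normrM.
rewrite (_ : (p - q) * h ^+ 2 = (A - h ^+ 2 * q) - (A - h ^+ 2 * p)); last by ring.
by rewrite (le_trans (ler_normB _ _)) // (le_trans (lerD K2 K1)) // -mulrDl -splitr.
Qed.
End SymmetryOfSecondDerivatives.

(** * Germs of smooth functions and tangent vectors *)

Section SmoothGerms.
Context (R : realType) (n : nat) (M : topologicalType)
  (A : smoothStructure R n M).
Implicit Types (f g : M -> R) (c d : chart R n M) (p q : M) (V : set M).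

Lemma open_chart_image c V : open V -> open (chart_cod c `&` chart_inv c @^-1` V).
Proof.
move=> oV; rewrite openE => x [cx Vx]; apply: filterI.
  by apply: open_nbhs_nbhs; split => //; exact: chart_open_cod.
have cx' : x \in chart_cod c by rewrite inE.
exact: (chart_inv_continuous cx') (open_nbhs_nbhs (conj oV Vx)).
Qed.

Lemma chart_image_mem c V p : chart_dom c p -> V p ->
  (chart_cod c `&` chart_inv c @^-1` V) (c p).
Proof. by move=> cp Vp; split; [exact: chart_to_cod|rewrite /= chart_toK]. Qed.

Lemma chart_inv_cvg c p : chart_dom c p -> chart_inv c x @[x --> c p] --> p.
Proof.
move=> cp; have cx : c p \in chart_cod c by rewrite inE; exact: chart_to_cod.
by have := chart_inv_continuous cx; rewrite /continuous_at chart_toK.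
Qed.

Lemma near_chart_dom c p : chart_dom c p -> \forall q \near p, chart_dom c q.
Proof. by move=> cp; apply: open_nbhs_nbhs; split => //; exact: chart_open_dom. Qed.

Definition smooth_near f p := exists V, [/\ open V, V p & smooth_fun A V f].

Lemma smooth_near_in V f p : open V -> V p -> smooth_fun A V f -> smooth_near f p.
Proof. by move=> oV Vp sf; exists V. Qed.

Lemma smooth_funP V f : (forall p, V p -> smooth_near f p) -> smooth_fun A V f.
Proof.
move=> sf c Ac k; apply: times_differentiable_local => x [cx Vx].
have [V' [oV' V'x sf']] := sf _ Vx.
by exists (chart_cod c `&` chart_inv c @^-1` V'); [split|exact: sf'].
Qed.

(** By compatibility of the atlas, smoothness in one chart around p gives
    smoothness in all of them. *)
Lemma smooth_near_chart c V f p : atlas A c -> chart_dom c p -> open V -> V p ->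
  smooth_on (chart_cod c `&` chart_inv c @^-1` V) (f \o chart_inv c) ->
  smooth_near f p.
Proof.
move=> Ac cp oV Vp sf; exists (V `&` chart_dom c).
have oVc : open (V `&` chart_dom c) by apply: openI => //; exact: chart_open_dom.
split=> // d Ad k; have oU := open_chart_image (c:=d) oVc.
apply: (@times_differentiable_eq _ _ _ _ _
  ((f \o chart_inv c) \o (c \o chart_inv d))) => //.
  by move=> x; rewrite inE => -[dx [Vx cx]] /=; rewrite chart_toK.
apply: (times_differentiable_comp oU _ _ (sf k)).
  by move=> x [dx [Vx cx]]; exact: chart_image_mem.
apply: times_differentiable_sub (atlas_compatible Ad Ac k).
by move=> x [dx [Vx cx]].
Qed.

Lemma near_chart c p (P : M -> Prop) : chart_dom c p -> (\forall q \near p, P q) ->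
  \forall x \near c p, P (chart_inv c x).
Proof. by move=> /chart_inv_cvg cp nP; exact: cp. Qed.

Lemma smooth_near_eq f g p :
  smooth_near f p -> (\forall q \near p, f q = g q) -> smooth_near g p.
Proof.
move=> [V [oV Vp sf]] fg; have : nbhs p (fun q => f q = g q) := fg.
rewrite nbhsE => -[W [oW Wp] fgW].
exists (V `&` W); split=> //; first exact: openI.
move=> c Ac k; apply: times_differentiable_eq (times_differentiable_sub _ (sf c Ac k)).
- by apply: open_chart_image; exact: openI.
- by move=> x; rewrite inE => -[_ [_ /fgW]].
- by move=> x [cx [Vx _]].
Qed.

Lemma smooth_near_diff f c p : smooth_near f p -> atlas A c -> chart_dom c p ->
  differentiable (f \o chart_inv c) (c p).
Proof.
move=> [V [oV Vp sf]] Ac cp; have [+ _] := sf c Ac 1%N; apply.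
exact: chart_image_mem.
Qed.

Lemma smooth_near_diff_at f p : smooth_near f p ->
  differentiable (f \o chart_inv (chart_at A p)) (chart_at A p p).
Proof.
move=> sf; apply: smooth_near_diff => //; first exact: chart_at_atlas.
exact: chart_at_dom.
Qed.

Lemma smooth_near_cst (a : R) p : smooth_near (fun=> a) p.
Proof.
exists setT; split=> // [|c Ac k]; first exact: openT.
exact: (@times_differentiable_cst _ _ _ _ _ a).
Qed.

Lemma smooth_nearD f g p :
  smooth_near f p -> smooth_near g p -> smooth_near (fun q => f q + g q) p.
Proof.
move=> [V [oV Vp sf]] [W [oW Wp sg]]; exists (V `&` W); have oVW := openI oV oW.
split=> // c Ac k; apply: (times_differentiableD (open_chart_image (c:=c) oVW)).
  by apply: times_differentiable_sub (sf c Ac k) => x [? []].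
by apply: times_differentiable_sub (sg c Ac k) => x [? []].
Qed.

Lemma smooth_nearM f g p :
  smooth_near f p -> smooth_near g p -> smooth_near (fun q => f q * g q) p.
Proof.
move=> [V [oV Vp sf]] [W [oW Wp sg]]; exists (V `&` W); have oVW := openI oV oW.
split=> // c Ac k; apply: (times_differentiableM (open_chart_image (c:=c) oVW)).
  by apply: times_differentiable_sub (sf c Ac k) => x [? []].
by apply: times_differentiable_sub (sg c Ac k) => x [? []].
Qed.

Lemma smooth_nearB f g p :
  smooth_near f p -> smooth_near g p -> smooth_near (fun q => f q - g q) p.
Proof.
move=> sf sg; have := smooth_nearD sf (smooth_nearM (smooth_near_cst (-1) p) sg).
by move=> /smooth_near_eq; apply; apply: nearW => q; rewrite mulN1r.
Qed.

Lemma smooth_near_sum (I : Type) (r : seq I) (f : I -> M -> R) p :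
  (forall i, smooth_near (f i) p) ->
  smooth_near (fun q => \sum_(i <- r) f i q) p.
Proof.
move=> sf; elim: r => [|i r IH].
  by apply: smooth_near_eq (smooth_near_cst 0 p) _; apply: nearW => q; rewrite big_nil.
apply: smooth_near_eq (smooth_nearD (sf i) IH) _.
by apply: nearW => q; rewrite big_cons.
Qed.

Local Notation "'dv'" := (deriv_along A).

Lemma deriv_along_linear f p a u v : dv f p (a *: u + v) = a * dv f p u + dv f p v.
Proof. by rewrite /deriv_along linearP. Qed.

Lemma deriv_along0 f p : dv f p 0 = 0.
Proof. by rewrite /deriv_along linear0. Qed.

Lemma deriv_alongD f p u v : dv f p (u + v) = dv f p u + dv f p v.
Proof. by rewrite /deriv_along linearD. Qed.

Lemma deriv_alongZ f p a u : dv f p (a *: u) = a * dv f p u.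
Proof. by rewrite -[_ *: _]addr0 deriv_along_linear deriv_along0 addr0. Qed.

Lemma deriv_along_sum (I : Type) (r : seq I) f p (u : I -> 'rV[R]_n) :
  dv f p (\sum_(i <- r) u i) = \sum_(i <- r) dv f p (u i).
Proof. by rewrite /deriv_along linear_sum. Qed.

Lemma deriv_along_eq f g p v : smooth_near f p ->
  (\forall q \near p, f q = g q) -> dv f p v = dv g p v.
Proof.
move=> sf fg; have := near_chart (chart_at_dom A p) fg.
by move=> /(near_eq_diff (smooth_near_diff_at sf))[_]; rewrite /deriv_along => ->.
Qed.

Lemma deriv_along_cst (a : R) p v : dv (fun=> a) p v = 0.
Proof.
rewrite /deriv_along (_ : _ \o _ = cst a); last by apply/funext.
by rewrite diff_cst.
Qed.

Lemma deriv_along_add f g p v : smooth_near f p -> smooth_near g p ->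
  dv (fun q => f q + g q) p v = dv f p v + dv g p v.
Proof.
move=> /smooth_near_diff_at df /smooth_near_diff_at dg.
by have /(congr1 (fun h => h v)) := diffD df dg.
Qed.

Lemma deriv_along_mul f g p v : smooth_near f p -> smooth_near g p ->
  dv (fun q => f q * g q) p v = dv f p v * g p + f p * dv g p v.
Proof.
move=> /smooth_near_diff_at df /smooth_near_diff_at dg.
have /(congr1 (fun h => h v)) := diffM df dg.
rewrite !fctE /= chart_toK; last exact: chart_at_dom.
by rewrite /deriv_along => ->; rewrite /GRing.scale /= addrC [g p * _]mulrC.
Qed.

Lemma deriv_along_sumf (I : Type) (r : seq I) (f : I -> M -> R) p v :
  (forall i, smooth_near (f i) p) ->
  dv (fun q => \sum_(i <- r) f i q) p v = \sum_(i <- r) dv (f i) p v.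
Proof.
move=> sf; elim: r => [|i r IH].
  rewrite big_nil -[RHS](deriv_along_cst 0 p v); congr (dv _ p v).
  by apply/funext => q; rewrite big_nil.
rewrite big_cons -IH -(deriv_along_add v (sf i) (smooth_near_sum r sf)).
by congr (dv _ p v); apply/funext => q; rewrite big_cons.
Qed.

Definition coord_fun c (i : 'I_n) : M -> R := fun q => c q 0 i.

Definition partial_fun c (i : 'I_n) f : M -> R :=
  fun q => 'D_(delta_mx 0 i) (f \o chart_inv c) (c q).

Lemma smooth_near_coord c p i : atlas A c -> chart_dom c p ->
  smooth_near (coord_fun c i) p.
Proof.
move=> Ac cp; exists (chart_dom c); split=> //; first exact: chart_open_dom.
move=> d Ad k; apply: (@times_differentiable_coord _ _ _ _ _ (c \o chart_inv d)).
  by apply: open_chart_image; exact: chart_open_dom.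
exact: (atlas_compatible Ad Ac k).
Qed.

(** The chain rule through a chart c that stays fixed near p; the preferred
    chart, in which the left-hand side is defined, changes from point to point. *)
Lemma deriv_along_partial f c p v : smooth_near f p -> atlas A c -> chart_dom c p ->
  dv f p v = \sum_i dv (coord_fun c i) p v * partial_fun c i f p.
Proof.
move=> sf Ac cp; set d := chart_at A p; have Ad : atlas A d := chart_at_atlas A p.
have dp : chart_dom d p := chart_at_dom A p.
have dt : differentiable (c \o chart_inv d) (d p).
  have [+ _] := atlas_compatible Ad Ac 1%N; apply; exact: chart_image_mem.
have df : differentiable (f \o chart_inv c) (c p) by exact: smooth_near_diff.
have tp : (c \o chart_inv d) (d p) = c p by rewrite /= chart_toK.
have dc : differentiable ((f \o chart_inv c) \o (c \o chart_inv d)) (d p).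
  by apply: differentiable_comp => //; rewrite tp.
rewrite {1}/deriv_along -/d.
have [_ ->] : differentiable (f \o chart_inv d) (d p) /\
  'd (f \o chart_inv d) (d p) = 'd ((f \o chart_inv c) \o (c \o chart_inv d)) (d p)
    :> ('rV[R]_n -> R).
  apply: near_eq_diff dc _; have := near_chart dp (near_chart_dom cp).
  by apply: filterS => x cx; rewrite /= chart_toK.
rewrite diff_comp ?tp //= diff_partial //; apply: eq_bigr => i _; congr (_ * _).
have di : differentiable (coord_fun c i \o chart_inv d) (d p).
  by apply: smooth_near_diff => //; exact: smooth_near_coord.
rewrite /deriv_along -/d -!deriveE // (derive_mx (M := c \o chart_inv d)) ?mxE //.
exact: diff_derivable.
Qed.

(** A tangent vector at p is by definition its components in the preferred
    chart. *)
Lemma deriv_along_chart p v i : dv (coord_fun (chart_at A p) i) p v = v 0 i.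
Proof.
rewrite /deriv_along; set d := chart_at A p.
have dp : chart_dom d p := chart_at_dom A p.
have Ad : atlas A d := chart_at_atlas A p.
have [di E] : differentiable (coord_fun d i \o chart_inv d) (d p) /\
  'd (coord_fun d i \o chart_inv d) (d p) = 'd (fun x : 'rV[R]_n => x 0 i) (d p)
    :> ('rV[R]_n -> R).
  apply: near_eq_diff; first exact: differentiable_coord.
  have : \forall x \near d p, chart_cod d x.
    by apply: open_nbhs_nbhs; split; [exact: chart_open_cod|exact: chart_to_cod].
  by apply: filterS => x dx; rewrite /= /coord_fun chart_invK.
rewrite E -deriveE; last exact: differentiable_coord.
have /(congr1 (fun N : 'rV[R]_n => N 0 i)) :=
  derive_mx (M := id) (@derivable_id _ _ (d p) v).
by rewrite mxE derive_id => <-.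
Qed.

(** Tangent vectors are told apart by the derivations that they define; this
    replaces computations with chart components by identities between
    derivatives of functions. *)
Lemma deriv_along_inj p u v :
  (forall f, smooth_near f p -> dv f p u = dv f p v) -> u = v.
Proof.
move=> uv; apply/rowP => i; rewrite -!(deriv_along_chart p); apply: uv.
by apply: smooth_near_coord; [exact: chart_at_atlas|exact: chart_at_dom].
Qed.

Lemma smooth_near_partial f c p i : smooth_near f p -> atlas A c -> chart_dom c p ->
  smooth_near (partial_fun c i f) p.
Proof.
move=> [V [oV Vp sf]] Ac cp; apply: (smooth_near_chart Ac cp oV Vp) => k.
have [_ /(_ (delta_mx 0 i)) D] := sf c Ac k.+1.
apply: times_differentiable_eq D; first exact: open_chart_image.
by move=> x; rewrite inE => -[cx _]; rewrite /partial_fun /= chart_invK.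
Qed.

Lemma partial_fun_comm f c p i j : smooth_near f p -> atlas A c -> chart_dom c p ->
  partial_fun c i (partial_fun c j f) p = partial_fun c j (partial_fun c i f) p.
Proof.
move=> [V [oV Vp sf]] Ac cp; have oU := open_chart_image (c:=c) oV.
have Up := chart_image_mem cp Vp.
have E k l : partial_fun c k (partial_fun c l f) p =
    'D_(delta_mx 0 k) ('D_(delta_mx 0 l) (f \o chart_inv c)) (c p).
  rewrite {1}/partial_fun; apply: near_eq_derive.
  have : \forall x \near c p, chart_cod c x.
    by apply: open_nbhs_nbhs; split; [exact: chart_open_cod|exact: chart_to_cod].
  by apply: filterS => x dx; rewrite /= /partial_fun chart_invK.
have [df D2] := sf c Ac 2; rewrite !E.
exact: derive_comm oU Up df (proj1 (D2 _) _ Up) (proj1 (D2 _) _ Up).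
Qed.
End SmoothGerms.

(** * Lie derivatives and brackets *)

Section VectorFieldCalculus.
Context (R : realType) (n : nat) (M : topologicalType)
  (A : smoothStructure R n M).
Implicit Types (f g : M -> R) (p q : M) (V : set M) (X Y Z : vfield A).

Local Notation sv := (smooth_vfield (A := A) setT).

Lemma smooth_vfieldP X :
  (forall f p, smooth_near A f p -> smooth_near A (lie_deriv X f) p) <-> sv X.
Proof.
split=> [sX V f oV _ sf|sX f p [V [oV Vp sf]]].
  by apply: smooth_funP => p Vp; apply: sX; exact: smooth_near_in sf.
by exists V; split=> //; exact: sX.
Qed.

Lemma smooth_near_lie X f p : sv X -> smooth_near A f p ->
  smooth_near A (lie_deriv X f) p.
Proof. by move=> /smooth_vfieldP; apply. Qed.

Lemma smooth_near_near f p : smooth_near A f p ->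
  \forall q \near p, smooth_near A f q.
Proof.
move=> [V [oV Vp sf]]; have := open_nbhs_nbhs (conj oV Vp).
by apply: filterS => q Vq; exact: smooth_near_in sf.
Qed.

Lemma lie_derivD X f g p : smooth_near A f p -> smooth_near A g p ->
  lie_deriv X (fun q => f q + g q) p = lie_deriv X f p + lie_deriv X g p.
Proof. exact: deriv_along_add. Qed.

Lemma lie_derivM X f g p : smooth_near A f p -> smooth_near A g p ->
  lie_deriv X (fun q => f q * g q) p = lie_deriv X f p * g p + f p * lie_deriv X g p.
Proof. exact: deriv_along_mul. Qed.

Lemma lie_deriv_sumf X (I : Type) (r : seq I) (f : I -> M -> R) p :
  (forall i, smooth_near A (f i) p) ->
  lie_deriv X (fun q => \sum_(i <- r) f i q) p = \sum_(i <- r) lie_deriv X (f i) p.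
Proof. exact: deriv_along_sumf. Qed.

Lemma lie_deriv_cst X (a : R) p : lie_deriv X (fun=> a) p = 0.
Proof. exact: deriv_along_cst. Qed.

Lemma lie_deriv_partial X f c p : smooth_near A f p -> atlas A c -> chart_dom c p ->
  \forall q \near p, lie_deriv X f q =
    \sum_i lie_deriv X (coord_fun c i) q * partial_fun c i f q.
Proof.
move=> /smooth_near_near sf Ac cp; near=> q; apply: deriv_along_partial => //.
  by near: q.
by near: q; exact: near_chart_dom.
Unshelve. all: by end_near. Qed.

(** The second sum is symmetric in X and Y up to the order of two partial
    derivatives, so it disappears from the commutator. *)
Lemma lie_deriv2_partial X Y f c p : sv X -> sv Y -> smooth_near A f p ->
    atlas A c -> chart_dom c p ->
  lie_deriv X (lie_deriv Y f) p =
    \sum_i lie_deriv X (lie_deriv Y (coord_fun c i)) p * partial_fun c i f p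
    + \sum_i \sum_j lie_deriv X (coord_fun c j) p * lie_deriv Y (coord_fun c i) p
        * partial_fun c j (partial_fun c i f) p.
Proof.
move=> sX sY sf Ac cp.
have sYc i : smooth_near A (lie_deriv Y (coord_fun c i)) p.
  by apply: smooth_near_lie => //; exact: smooth_near_coord.
have sp i : smooth_near A (partial_fun c i f) p by exact: smooth_near_partial.
rewrite {1}/lie_deriv (deriv_along_eq (X p) (smooth_near_lie sY sf)
  (lie_deriv_partial Y sf Ac cp)).
rewrite deriv_along_sumf; last by move=> i; exact: smooth_nearM.
rewrite -big_split; apply: eq_bigr => i _ /=.
rewrite (deriv_along_mul (X p) (sYc i) (sp i)); congr (_ + _).
rewrite (deriv_along_partial (X p) (sp i) Ac cp) mulr_sumr.
by apply: eq_bigr => j _; rewrite /lie_deriv; ring.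
Qed.

(** The bracket is defined by its action on the coordinate functions of the
    preferred chart; [derive_comm] extends that action to all functions. *)
Lemma lie_bracketE X Y f p : sv X -> sv Y -> smooth_near A f p ->
  lie_deriv (lie_bracket X Y) f p =
  lie_deriv X (lie_deriv Y f) p - lie_deriv Y (lie_deriv X f) p.
Proof.
move=> sX sY sf; set c := chart_at A p.
have Ac : atlas A c := chart_at_atlas A p.
have cp : chart_dom c p := chart_at_dom A p.
rewrite (lie_deriv2_partial sX sY sf Ac cp) (lie_deriv2_partial sY sX sf Ac cp).
rewrite [X in _ = _ - (_ + X)]exchange_big /= opprD addrACA.
rewrite -[LHS]addr0; congr (_ + _).
  rewrite /lie_deriv (deriv_along_partial _ sf Ac cp) -sumrB; apply: eq_bigr => i _.
  by rewrite deriv_along_chart mxE -mulrBl.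
apply/esym/eqP; rewrite subr_eq0; apply/eqP.
apply: eq_bigr => i _; apply: eq_bigr => j _.
by rewrite (partial_fun_comm j i sf Ac cp) [X in X * _]mulrC.
Qed.

Lemma smooth_lie_bracket X Y : sv X -> sv Y -> sv (lie_bracket X Y).
Proof.
move=> sX sY; apply/smooth_vfieldP => f p sf.
have sXY := smooth_near_lie sX (smooth_near_lie sY sf).
have sYX := smooth_near_lie sY (smooth_near_lie sX sf).
apply: smooth_near_eq (smooth_nearB sXY sYX) _.
by apply: filterS (smooth_near_near sf) => q sfq; rewrite lie_bracketE.
Qed.

Lemma smooth_vfield_sum (I : Type) (r : seq I) (f : I -> M -> R) (X : I -> vfield A) :
  (forall i p, smooth_near A (f i) p) -> (forall i, sv (X i)) ->
  sv (fun p => \sum_(i <- r) f i p *: X i p).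
Proof.
move=> sf sX; apply/smooth_vfieldP => g p sg.
have : smooth_near A (fun q => \sum_(i <- r) f i q * lie_deriv (X i) g q) p.
  by apply: smooth_near_sum => i; apply: smooth_nearM => //; exact: smooth_near_lie.
move=> /smooth_near_eq; apply; apply: nearW => q; rewrite /lie_deriv deriv_along_sum.
by apply: eq_bigr => i _; rewrite deriv_alongZ.
Qed.

Lemma smooth_fun_near f p : smooth_fun A setT f -> smooth_near A f p.
Proof. by move=> sf; exists setT; split=> //; exact: openT. Qed.

Lemma smooth_near_metric (g : riemannianMetric A) X Y p : sv X -> sv Y ->
  smooth_near A (fun q => g q (X q) (Y q)) p.
Proof.
by move=> sX sY; apply: smooth_fun_near; exact: (metric_smooth g openT sX sY).
Qed.
End VectorFieldCalculus.

(** * Orthonormal bases of a tangent space *)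

Section MetricAlgebra.
Context (R : realType) (n : nat) (M : topologicalType)
  (A : smoothStructure R n M) (g : riemannianMetric A) (p : M).
Implicit Types u v w : 'rV[R]_n.

Lemma metricDl u v w : g p (u + v) w = g p u w + g p v w.
Proof. by rewrite -{1}[u]scale1r metric_linear mul1r. Qed.

Lemma metric0l w : g p 0 w = 0.
Proof. by apply: (addrI (g p 0 w)); rewrite -metricDl !addr0. Qed.

Lemma metricZl a u w : g p (a *: u) w = a * g p u w.
Proof. by rewrite -[_ *: _]addr0 metric_linear metric0l addr0. Qed.

Lemma metricNl u w : g p (- u) w = - g p u w.
Proof. by rewrite -scaleN1r metricZl mulN1r. Qed.

Lemma metricBl u v w : g p (u - v) w = g p u w - g p v w.
Proof. by rewrite metricDl metricNl. Qed.

Lemma metricZr a u w : g p w (a *: u) = a * g p w u.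
Proof. by rewrite !(Defs.metric_sym g p w) metricZl. Qed.

Lemma metric_suml (I : Type) (r : seq I) (u : I -> 'rV[R]_n) w :
  g p (\sum_(i <- r) u i) w = \sum_(i <- r) g p (u i) w.
Proof. by elim/big_rec2: _ => [|i x y _ <-]; rewrite ?metric0l ?metricDl. Qed.

Definition orthonormal_at m (e : 'I_m -> 'rV[R]_n) :=
  forall i j, g p (e i) (e j) = (i == j)%:R.

Lemma orthonormal_comb m (e : 'I_m -> 'rV[R]_n) (a : 'I_m -> R) j :
  orthonormal_at e -> g p (\sum_i a i *: e i) (e j) = a j.
Proof.
move=> oe; rewrite metric_suml (bigD1 j) //= metricZl oe eqxx mulr1 big1 ?addr0 //.
by move=> i /negPf ij; rewrite metricZl oe ij mulr0.
Qed.

(** An orthonormal family is free, and n free vectors span. *)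
Lemma orthonormal_expand (e : 'I_n -> 'rV[R]_n) u :
  orthonormal_at e -> u = \sum_i g p u (e i) *: e i.
Proof.
move=> oe; pose B : 'M[R]_n := \matrix_i e i.
have fB : row_free B.
  apply/inj_row_free => v vB.
  apply/rowP => i; rewrite mxE -(orthonormal_comb (fun i => v 0 i) i oe).
  have -> : \sum_j v 0 j *: e j = v *m B.
    by rewrite mulmx_sum_row; apply: eq_bigr => j _; rewrite rowK.
  by rewrite vB metric0l.
have uB : (u <= B)%MS by apply: submx_full; rewrite row_full_unit -row_free_unit.
have [a ->] := submxP uB; rewrite mulmx_sum_row; apply: eq_bigr => i _.
rewrite rowK; congr (_ *: _).
by under eq_bigr do rewrite rowK; rewrite (orthonormal_comb (fun i => a 0 i)).
Qed.

(** Gram-Schmidt: fewer than n vectors have a nonzero common orthogonal, which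
    is an element of the kernel of the matrix of their inner products with the
    standard basis. *)
Lemma orthonormal_sub m : (m <= n)%N -> exists e : 'I_m -> 'rV[R]_n, orthonormal_at e.
Proof.
elim: m => [_|m IH lt_mn]; first by exists (fun=> 0) => -[].
have [e oe] := IH (ltnW lt_mn).
pose B : 'M[R]_(n, m) := \matrix_(k, i) g p (delta_mx 0 k) (e i).
have BE (v : 'rV[R]_n) i : (v *m B) 0 i = g p v (e i).
  rewrite {2}(row_sum_delta v) metric_suml mxE; apply: eq_bigr => k _.
  by rewrite metricZl mxE.
have : kermx B != 0.
  rewrite -mxrank_eq0 mxrank_ker subn_eq0 -ltnNge.
  by apply: leq_ltn_trans lt_mn; exact: rank_leq_col.
move=> /rowV0Pn[v /sub_kermxP vB v0].
have vv := metric_pos g p v0.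
pose u := (Num.sqrt (g p v v))^-1 *: v.
have ue i : g p u (e i) = 0 by rewrite metricZl -BE vB mxE mulr0.
have uu : g p u u = 1.
  rewrite metricZl metricZr mulrA -expr2 exprVn sqr_sqrtr ?ltW //.
  by rewrite mulVf // gt_eqF.
exists (fun i => if unlift ord0 i is Some j then e j else u) => i j.
case: unliftP => [i'|] ->; case: unliftP => [j'|] ->.
- by rewrite oe (inj_eq lift_inj).
- by rewrite Defs.metric_sym ue eq_sym (negPf (neq_lift _ _)).
- by rewrite ue (negPf (neq_lift _ _)).
- by rewrite uu eqxx.
Qed.
End MetricAlgebra.

(** * Left translations and left invariant fields *)

Section LeftTranslations.
Context (R : realType) (n : nat) (N : topologicalGroupType)
  (A : smoothStructure R n N) (hlie : lie_group A).
Implicit Types (f : N -> R) (a p q : N) (c d e : chart R n N) (V : set N) (X Y :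
  vfield A).

Local Notation sv := (smooth_vfield (A := A) setT).
Local Notation transl a := (fun q : N => (a * q)%g).

Lemma transl_continuous a : continuous (transl a).
Proof.
move=> p; have ap : (a, q) @[q --> p] --> (a, p).
  by apply: cvg_pair; [exact: cvg_cst|exact: cvg_id].
exact: (cvg_comp _ _ ap (mulg_continuous (a, p))).
Qed.

Definition product_domain c d V : set ('rV[R]_n * 'rV[R]_n) :=
  [set x | [/\ chart_cod c x.1, chart_cod d x.2 &
    V (chart_inv c x.1 * chart_inv d x.2)%g]].

Lemma open_product_domain c d V : open V -> open (product_domain c d V).
Proof.
move=> oV; rewrite openE => -[x y] [/= cx dy Vxy].
have cx' : x \in chart_cod c by rewrite inE.
have dy' : y \in chart_cod d by rewrite inE.
have fx : z.1 @[z --> (x, y)] --> x by exact: cvg_fst.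
have fy : z.2 @[z --> (x, y)] --> y by exact: cvg_snd.
have fc : chart_inv c z.1 @[z --> (x, y)] --> chart_inv c x.
  exact: (cvg_comp _ _ fx (chart_inv_continuous cx')).
have fd : chart_inv d z.2 @[z --> (x, y)] --> chart_inv d y.
  exact: (cvg_comp _ _ fy (chart_inv_continuous dy')).
have fm : (chart_inv c z.1 * chart_inv d z.2)%g @[z --> (x, y)]
    --> (chart_inv c x * chart_inv d y)%g.
  exact: (cvg_comp _ _ (cvg_pair fc fd) (mulg_continuous (chart_inv c x,
    chart_inv d y))).
have nx : \forall z \near (x, y), chart_cod c z.1.
  by apply: fx; apply: open_nbhs_nbhs; split; [exact: chart_open_cod|].
have ny : \forall z \near (x, y), chart_cod d z.2.
  by apply: fy; apply: open_nbhs_nbhs; split; [exact: chart_open_cod|].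
have nV : \forall z \near (x, y), V (chart_inv c z.1 * chart_inv d z.2)%g.
  by apply: fm; exact: open_nbhs_nbhs.
by apply: filterS (filterI nx (filterI ny nV)) => z [? []].
Qed.

Lemma is_diff_slicel (x y : 'rV[R]_n) :
  is_diff x (fun x' => (x', y)) (fun u => (u, 0 : 'rV[R]_n)).
Proof. exact: (is_diff_pair (is_diff_id x) (is_diff_cst y x)). Qed.

Lemma is_diff_slicer (x y : 'rV[R]_n) :
  is_diff y (fun y' => (x, y')) (fun u => (0 : 'rV[R]_n, u)).
Proof. exact: (is_diff_pair (is_diff_cst x y) (is_diff_id y)). Qed.

(** The definition of a Lie group gives smoothness of the product in charts; a
    smooth function of the product is locally its composition with a chart at
    the product. *)
Lemma smooth_on_product f V c d : atlas A c -> atlas A d -> open V ->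
  smooth_fun A V f ->
  smooth_on (product_domain c d V) (fun x => f (chart_inv c x.1 * chart_inv d x.2)%g).
Proof.
move=> Ac Ad oV sf k; apply: times_differentiable_local => -[x y] [/= cx dy Vxy].
set r := (chart_inv c x * chart_inv d y)%g in Vxy.
set e := chart_at A r; have Ae : atlas A e := chart_at_atlas A r.
have er : chart_dom e r := chart_at_dom A r.
have oW := openI oV (@chart_open_dom _ _ _ e).
exists (product_domain c d (V `&` chart_dom e)); first by split.
have oU := open_product_domain (c:=c) (d:=d) oW.
apply: (@times_differentiable_eq _ _ _ _ _ ((f \o chart_inv e) \o
  (fun x => e (chart_inv c x.1 * chart_inv d x.2)%g))) => //.
  by move=> z; rewrite inE => -[_ _ [_ ez]] /=; rewrite chart_toK.
apply: (times_differentiable_comp oU _ _ (sf e Ae k)).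
  by move=> z [_ _ [Vz ez]]; exact: chart_image_mem.
by apply: times_differentiable_sub (hlie.1 c d e Ac Ad Ae k) => z [? ? []].
Qed.

(** A left translation is the multiplication with its first argument fixed at
    the chart image of a. *)
Lemma smooth_on_transl a c d : atlas A c -> atlas A d ->
  smooth_on (chart_cod c `&` chart_inv c @^-1` (transl a @^-1` chart_dom d))
            (d \o transl a \o chart_inv c).
Proof.
move=> Ac Ad k; set b := chart_at A a; have ba := chart_at_dom A a.
have Ab := chart_at_atlas A a.
have oD := open_product_domain (c:=b) (d:=c) (@chart_open_dom _ _ _ d).
have oU : open (transl a @^-1` chart_dom d).
  by apply: open_comp (@chart_open_dom _ _ _ d) => q _; exact: transl_continuous.
have := times_differentiable_affine (@is_diff_slicer (b a)) oD
  (hlie.1 b c d Ab Ac Ad k).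
move=> /(@times_differentiable_sub _ _ _ _ _
  (chart_cod c `&` chart_inv c @^-1` (transl a @^-1` chart_dom d))) H.
apply: times_differentiable_eq (H _); first exact: open_chart_image.
  by move=> x _; rewrite /= chart_toK.
by move=> x [cx dx]; split => //=; [exact: chart_to_cod|rewrite chart_toK].
Qed.

Lemma smooth_near_transl f a p : smooth_near A f (a * p)%g ->
  smooth_near A (f \o transl a) p.
Proof.
move=> [V [oV Vp sf]].
set d := chart_at A (a * p)%g; have Ad : atlas A d := chart_at_atlas A _.
have dp : chart_dom d (a * p)%g := chart_at_dom A _.
set c := chart_at A p; have Ac : atlas A c := chart_at_atlas A _.
have cp : chart_dom c p := chart_at_dom A _.
have oW : open (transl a @^-1` (V `&` chart_dom d)).
  apply: open_comp (openI oV (@chart_open_dom _ _ _ d)) => q _;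
    exact: transl_continuous.
apply: (smooth_near_chart Ac cp oW) => // k.
have oU := open_chart_image (c:=c) oW.
apply: (@times_differentiable_eq _ _ _ _ _ ((f \o chart_inv d) \o
  (d \o transl a \o chart_inv c))) => //.
  by move=> x; rewrite inE => -[_ [_ dx]] /=; rewrite chart_toK.
apply: (times_differentiable_comp oU _ _ (sf d Ad k)).
  by move=> x [_ [Vx dx]]; exact: chart_image_mem.
by apply: times_differentiable_sub (smooth_on_transl a Ac Ad k) => x [cx [_ dx]].
Qed.

(** By the chain rule; this turns left invariance into a property of the
    derivations. *)
Lemma deriv_along_transl f a p v : smooth_near A f (a * p)%g ->
  deriv_along A f (a * p)%g (tangent_map A (transl a) p v) =
  deriv_along A (f \o transl a) p v.
Proof.
move=> sf; rewrite /tangent_map.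
set d := chart_at A (a * p)%g; have Ad : atlas A d := chart_at_atlas A _.
have dp : chart_dom d (a * p)%g := chart_at_dom A _.
set c := chart_at A p; have Ac : atlas A c := chart_at_atlas A _.
have cp : chart_dom c p := chart_at_dom A _.
have dT : differentiable (d \o transl a \o chart_inv c) (c p).
  have [+ _] := smooth_on_transl a Ac Ad 1%N; apply.
  by split; [exact: chart_to_cod|rewrite /= chart_toK].
have Tp : (d \o transl a \o chart_inv c) (c p) = d (a * p)%g by rewrite /= chart_toK.
have df : differentiable (f \o chart_inv d) ((d \o transl a \o chart_inv c) (c p)).
  by rewrite Tp; exact: (smooth_near_diff sf Ad dp).
have dc := differentiable_comp dT df.
have [_ E] : differentiable ((f \o transl a) \o chart_inv c) (c p) /\
  'd ((f \o transl a) \o chart_inv c) (c p) =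
  'd ((f \o chart_inv d) \o (d \o transl a \o chart_inv c)) (c p) :> ('rV[R]_n -> R).
  apply: near_eq_diff dc _.
  have : \forall q \near p, chart_dom d (a * q)%g.
    by apply: transl_continuous; exact: near_chart_dom.
  by move=> /(near_chart cp); apply: filterS => x dx; rewrite /= chart_toK.
rewrite [RHS]/deriv_along -/c E (diff_comp dT df).
by rewrite /deriv_along -/d [RHS]/comp Tp.
Qed.

Definition left_invariant X :=
  forall a p, X (a * p)%g = tangent_map A (transl a) p (X p).

Lemma left_invariant_lie X f a p : left_invariant X -> smooth_near A f (a * p)%g ->
  \forall q \near p, lie_deriv X (f \o transl a) q = lie_deriv X f (a * q)%g.
Proof.
move=> lX /smooth_near_near sf.
have : \forall q \near p, smooth_near A f (a * q)%g by apply: transl_continuous.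
by apply: filterS => q sq; rewrite /lie_deriv lX deriv_along_transl.
Qed.

(** A field is left invariant when it commutes with f |-> f o transl a on smooth
    germs, and this passes to commutators. *)
Lemma left_invariant_bracket X Y : sv X -> sv Y -> left_invariant X ->
  left_invariant Y -> left_invariant (lie_bracket X Y).
Proof.
move=> sX sY lX lY a p; apply: (@deriv_along_inj _ _ _ A (a * p)%g) => f sf.
rewrite deriv_along_transl // -![deriv_along A _ _ (lie_bracket X Y _)]/(lie_deriv
  (lie_bracket X Y) _ _).
have sft := smooth_near_transl sf.
have E Z W : sv W -> left_invariant Z -> left_invariant W ->
    lie_deriv Z (lie_deriv W (f \o transl a)) p = lie_deriv Z (lie_deriv W f) (a * p)%g.
  move=> sW lZ lW; rewrite {1}/lie_deriv.
  rewrite (deriv_along_eq (Z p) (smooth_near_lie sW sft) (left_invariant_lie lW sf)).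
  exact: (nbhs_singleton (left_invariant_lie lZ (smooth_near_lie sW sf))).
by rewrite (lie_bracketE sX sY sf) (lie_bracketE sX sY sft)
  (E X Y sY lX lY) (E Y X sX lY lX).
Qed.

Definition invariant_field (v : 'rV[R]_n) : vfield A :=
  fun a => tangent_map A (transl a) 1%g v.

Lemma deriv_along_invariant_field f a v : smooth_near A f a ->
  deriv_along A f a (invariant_field v a) = deriv_along A (f \o transl a) 1%g v.
Proof.
by move=> sf; rewrite -deriv_along_transl mulg1.
Qed.

Lemma left_invariant_field v : left_invariant (invariant_field v).
Proof.
move=> a p; apply: (@deriv_along_inj _ _ _ A (a * p)%g) => f sf.
have sft := smooth_near_transl sf.
rewrite (deriv_along_invariant_field v sf) (deriv_along_transl _ sf).
rewrite (deriv_along_invariant_field v sft).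
by congr (deriv_along A _ _ _); apply/funext => q; rewrite /= mulgA.
Qed.

(** The derivative of f along the field at a is the derivative at y = 1 of
    f (a y), that is, D_(0, v) F (a, 1) for the function F (x, y) = f (x y), which is
    smooth in both arguments. *)
Lemma smooth_invariant_field v : sv (invariant_field v).
Proof.
apply/smooth_vfieldP => f p [V [oV Vp sf]].
set c := chart_at A p; have Ac : atlas A c := chart_at_atlas A _.
have cp : chart_dom c p := chart_at_dom A _.
set e := chart_at A 1%g; have Ae : atlas A e := chart_at_atlas A _.
have e1 : chart_dom e 1%g := chart_at_dom A _.
apply: (smooth_near_chart Ac cp oV Vp) => k.
(* The function (x, y) |-> f (x y) in charts at p and at 1. *)
pose F (x : 'rV[R]_n * 'rV[R]_n) := f (chart_inv c x.1 * chart_inv e x.2)%g.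
have sF : smooth_on (product_domain c e V) F by exact: smooth_on_product.
have oD := open_product_domain (c:=c) (d:=e) oV.
have UD x : (chart_cod c `&` chart_inv c @^-1` V) x -> product_domain c e V (x, e 1%g).
  by move=> [cx Vx]; split => //=; [exact: chart_to_cod|rewrite chart_toK // mulg1].
have [_ /(_ (0, v)) DF] := sF k.+1.
have := times_differentiable_affine (fun x => is_diff_slicel x (e 1%g)) oD DF.
move=> /(times_differentiable_sub UD); apply: times_differentiable_eq.
  exact: open_chart_image.
move=> x; rewrite inE => Ux /=; have [cx Vx] := Ux.
have [dF _] := sF 1%N; have dFx := dF _ (UD x Ux).
rewrite /lie_deriv deriv_along_invariant_field; last exact: smooth_near_in sf.
rewrite deriveE // /deriv_along -/e.
rewrite (_ : _ \o chart_inv e = F \o (fun y => (x, y))) //.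
have [ds sE] := is_diff_slicer x (e 1%g).
by rewrite diff_comp //= sE.
Qed.
End LeftTranslations.

(** * Curvature as algebra in the structure constants *)

Section StructureConstants.
Context (R : realFieldType) (n : nat).
Implicit Types (t c : 'I_n -> 'I_n -> 'I_n -> R) (x y z : 'I_n -> R) (i j k l m : 'I_n).

(** The bilinear map with components t_ijk in the frame. *)
Definition contract t x y k := \sum_i \sum_j x i * y j * t i j k.

Lemma contractDl t x x' y k :
  contract t (fun i => x i + x' i) y k = contract t x y k + contract t x' y k.
Proof.
rewrite -big_split; apply: eq_bigr => i _ /=; rewrite -big_split.
by apply: eq_bigr => j _ /=; ring.
Qed.

Lemma contractDr t x x' y k :
  contract t y (fun i => x i + x' i) k = contract t y x k + contract t y x' k.
Proof.
rewrite -big_split; apply: eq_bigr => i _ /=; rewrite -big_split.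
by apply: eq_bigr => j _ /=; ring.
Qed.

Lemma contractZl t a x y k : contract t (fun i => a * x i) y k = a * contract t x y k.
Proof.
rewrite mulr_sumr; apply: eq_bigr => i _ /=; rewrite mulr_sumr.
by apply: eq_bigr => j _ /=; ring.
Qed.

Lemma contractZr t a x y k : contract t y (fun i => a * x i) k = a * contract t y x k.
Proof.
rewrite mulr_sumr; apply: eq_bigr => i _ /=; rewrite mulr_sumr.
by apply: eq_bigr => j _ /=; ring.
Qed.

Lemma contractBl t x x' y k :
  contract t (fun i => x i - x' i) y k = contract t x y k - contract t x' y k.
Proof.
rewrite contractDl (_ : (fun i => - x' i) = (fun i => -1 * x' i)) ?contractZl
  ?mulN1r //.
by apply/funext => i; rewrite mulN1r.
Qed.

Definition sum3 (F : 'I_n -> 'I_n -> 'I_n -> R) := \sum_i \sum_j \sum_k F i j k.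

Lemma sum3_swap12 F : sum3 F = sum3 (fun i j k => F j i k).
Proof. exact: exchange_big. Qed.

Lemma sum3_swap23 F : sum3 F = sum3 (fun i j k => F i k j).
Proof. by apply: eq_bigr => i _; exact: exchange_big. Qed.

Lemma sum3D F G : sum3 (fun i j k => F i j k + G i j k) = sum3 F + sum3 G.
Proof.
rewrite -big_split; apply: eq_bigr => i _; rewrite -big_split.
by apply: eq_bigr => j _; rewrite -big_split.
Qed.

Lemma sum3Z a F : sum3 (fun i j k => a * F i j k) = a * sum3 F.
Proof.
rewrite mulr_sumr; apply: eq_bigr => i _; rewrite mulr_sumr.
by apply: eq_bigr => j _; rewrite mulr_sumr.
Qed.

Lemma sum3_eq F G : (forall i j k, F i j k = G i j k) -> sum3 F = sum3 G.
Proof. by move=> FG; do 3!(apply: eq_bigr => ? _); exact: FG. Qed.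

Lemma sum3_rot F : sum3 (fun i j k => F j k i) = sum3 F.
Proof. by rewrite [RHS]sum3_swap23 sum3_swap12. Qed.

Lemma sum_delta (F : 'I_n -> R) i : \sum_j (i == j)%:R * F j = F i.
Proof.
rewrite (bigD1 i) //= eqxx mul1r big1 ?addr0 // => j.
by rewrite eq_sym => /negPf ->; rewrite mul0r.
Qed.

(** For a square matrix B B^T = 1 implies B^T B = 1. *)
Lemma orthogonal_columns (B : 'M[R]_n) a b : B *m B^T = 1%:M ->
  \sum_i B i a * B i b = (a == b)%:R.
Proof.
move=> /mulmx1C /matrixP /(_ a b); rewrite !mxE => <-.
by apply: eq_bigr => i _; rewrite mxE.
Qed.

Variable c : 'I_n -> 'I_n -> 'I_n -> R.

(** The coordinates <nabla_(E_i) E_j, E_k> that the Koszul formula dictates. *)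
Definition christoffel i j k := (c i j k - c j k i + c k i j) / 2.

(** For constant coordinates x, y, z, the coordinates of
    nabla_x nabla_y z - nabla_y nabla_x z - nabla_[x, y] z. *)
Definition riemann_form x y z k :=
  contract christoffel x (contract christoffel y z) k
  - contract christoffel y (contract christoffel x z) k
  - contract christoffel (contract c x y) z k.

Definition riemann_coef i j k l :=
  \sum_m (christoffel j k m * christoffel i m l
          - christoffel i k m * christoffel j m l - c i j m * christoffel m k l).

Lemma riemann_formE x y z l :
  riemann_form x y z l = \sum_i \sum_j \sum_k x i * y j * z k * riemann_coef i j k l.
Proof.
have E1 x' y' : contract christoffel x' (contract christoffel y' z) l =
    \sum_i \sum_j \sum_k x' i * y' j * z k * \sum_m christoffel j k m
      * christoffel i m l.
  apply: eq_bigr => i _.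
  transitivity (\sum_m \sum_j \sum_k x' i * y' j * z k * (christoffel j k m
    * christoffel i m l)).
    apply: eq_bigr => m _; rewrite mulr_sumr mulr_suml; apply: eq_bigr => j _.
    by rewrite mulr_sumr mulr_suml; apply: eq_bigr => k _; ring.
  rewrite exchange_big; apply: eq_bigr => j _; rewrite exchange_big.
  by apply: eq_bigr => k _; rewrite mulr_sumr.
have E2 : contract christoffel y (contract christoffel x z) l =
    \sum_i \sum_j \sum_k x i * y j * z k * \sum_m christoffel i k m * christoffel j m l.
  rewrite E1 exchange_big; apply: eq_bigr => i _; apply: eq_bigr => j _.
  by apply: eq_bigr => k _; ring.
have E3 : contract christoffel (contract c x y) z l =
    \sum_i \sum_j \sum_k x i * y j * z k * \sum_m c i j m * christoffel m k l.
  transitivity (\sum_m \sum_k \sum_i \sum_j x i * y j * z k * (c i j m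
    * christoffel m k l)).
    apply: eq_bigr => m _; apply: eq_bigr => k _.
    rewrite !mulr_suml; apply: eq_bigr => i _; rewrite !mulr_suml.
    by apply: eq_bigr => j _; ring.
  transitivity (\sum_i \sum_m \sum_k \sum_j x i * y j * z k * (c i j m
    * christoffel m k l)).
    rewrite exchange_big /=; under eq_bigr do rewrite exchange_big /=.
    by rewrite exchange_big /=; apply: eq_bigr => i _; rewrite exchange_big.
  apply: eq_bigr => i _.
  transitivity (\sum_m \sum_j \sum_k x i * y j * z k * (c i j m * christoffel m k l)).
    by apply: eq_bigr => m _; rewrite exchange_big.
  rewrite exchange_big; apply: eq_bigr => j _; rewrite exchange_big.
  by apply: eq_bigr => k _; rewrite mulr_sumr.
rewrite /riemann_form E1 E2 E3 -!sumrB; apply: eq_bigr => i _.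
rewrite -!sumrB; apply: eq_bigr => j _; rewrite -!sumrB; apply: eq_bigr => k _.
by rewrite -!mulrBr /riemann_coef !sumrB.
Qed.

Definition scalar_of_struct := \sum_i \sum_j riemann_coef i j j i.

(** The two contractions of the trace each produce the matrix B^T B = 1. *)
Lemma trace_frame_independent (B : 'M[R]_n) : B *m B^T = 1%:M ->
  \sum_i \sum_j \sum_l riemann_form (B i) (B j) (B j) l * B i l = scalar_of_struct.
Proof.
move=> BB.
transitivity (\sum_i \sum_j \sum_l \sum_a \sum_b \sum_k
    (B i a * B i l) * (B j b * B j k) * riemann_coef a b k l).
  apply: eq_bigr => i _; apply: eq_bigr => j _; apply: eq_bigr => l _.
  rewrite riemann_formE mulr_suml; apply: eq_bigr => a _; rewrite mulr_suml.
  apply: eq_bigr => b _; rewrite mulr_suml; apply: eq_bigr => k _; ring.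
transitivity (\sum_l \sum_a \sum_b \sum_k
    (\sum_i B i a * B i l) * (\sum_j B j b * B j k) * riemann_coef a b k l).
  under eq_bigr do rewrite exchange_big /=.
  rewrite exchange_big; apply: eq_bigr => l _ /=.
  under eq_bigr do rewrite exchange_big /=.
  rewrite exchange_big; apply: eq_bigr => a _ /=.
  under eq_bigr do rewrite exchange_big /=.
  rewrite exchange_big; apply: eq_bigr => b _ /=.
  under eq_bigr do rewrite exchange_big /=.
  rewrite exchange_big; apply: eq_bigr => k _ /=.
  rewrite !mulr_suml; apply: eq_bigr => i _.
  by rewrite -mulr_suml -mulr_sumr.
rewrite exchange_big; apply: eq_bigr => a _ /=.
rewrite exchange_big; apply: eq_bigr => b _ /=.
rewrite -[RHS](sum_delta (fun l => riemann_coef a b b l)); apply: eq_bigr => l _.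
rewrite -[in RHS](sum_delta (fun k => riemann_coef a b k l)) mulr_sumr.
by apply: eq_bigr => k _; rewrite !orthogonal_columns // mulrA.
Qed.

Section Antisymmetric.
Hypothesis struct_antisym : forall i j k, c i j k = - c j i k.

(** Equivalent to the compatibility of the connection with the metric. *)
Lemma christoffel_metric i j k : christoffel i j k + christoffel i k j = 0.
Proof.
rewrite /christoffel (struct_antisym i k j) (struct_antisym k j i).
by rewrite (struct_antisym j i k); lra.
Qed.

(** Equivalent to the vanishing of the torsion. *)
Lemma christoffel_torsion i j k : christoffel i j k - christoffel j i k = c i j k.
Proof.
rewrite /christoffel (struct_antisym j i k) (struct_antisym i k j).
by rewrite (struct_antisym k j i); lra.
Qed.

Lemma struct_diag i k : c i i k = 0.
Proof. by have := struct_antisym i i k; lra. Qed.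

Lemma sum_sqr_struct :
  \sum_m (\sum_i c m i i) ^+ 2 = sum3 (fun i j m => c m i i * c m j j).
Proof.
rewrite -sum3_rot; apply: eq_bigr => m _.
rewrite expr2 mulr_suml; apply: eq_bigr => i _; exact: mulr_sumr.
Qed.

(** The three sums are sum_i |ad E_i|^2, sum_i tr (ad E_i)^2 and
    sum_i (tr ad E_i)^2.  After expansion every product of two structure
    constants is, up to antisymmetry, a term of one of them with its indices
    permuted. *)
Lemma scalar_of_structE : scalar_of_struct =
  - (1 / 4) * sum3 (fun i j k => c i j k ^+ 2)
  - (1 / 2) * sum3 (fun i j k => c i j k * c i k j)
  - \sum_m (\sum_i c m i i) ^+ 2.
Proof.
pose q i j k := c i j k ^+ 2; pose h i j k := c i j k * c i k j.
rewrite sum_sqr_struct -[sum3 (fun i j k => c i j k ^+ 2)]/(sum3 q).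
rewrite -[sum3 (fun i j k => c i j k * c i k j)]/(sum3 h).
(* With P = c_ijk, Q = c_jki, S = c_kij the product of Christoffel symbols
   - Gamma_ijk Gamma_jki is (Q^2 + S^2 - P^2 - 2 Q S) / 4; the other terms are
   - c_ijk Gamma_kji and Gamma_jjk Gamma_iki. *)
transitivity (sum3 (fun i j k => - (3 / 4) * q i j k + 1 / 4 * q j k i + 1 / 4 * q k i j
  + 1 / 2 * h k i j + - (1 / 2) * h j i k + - (1 / 2) * h i j k
  + - 1 * (c k i i * c k j j))).
  apply: sum3_eq => i j k; rewrite /christoffel /q /h.
  rewrite !struct_diag (struct_antisym j k j) (struct_antisym i k i).
  rewrite (struct_antisym j i k) (struct_antisym k j i) (struct_antisym i k j).
  by field.
rewrite !sum3D !sum3Z -(sum3_swap12 h) (sum3_rot q) (sum3_rot (fun i j k => q j k i)).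
rewrite (sum3_rot q) (sum3_rot (fun i j k => h j k i)) (sum3_rot h).
by field.
Qed.

(** The first hypothesis says that (ad E_i)^2 = 0, so that its trace vanishes. *)
Lemma scalar_of_struct_lt0 : (forall i j k, \sum_l c i j l * c i l k = 0) ->
  (exists i j k, c i j k != 0) -> scalar_of_struct < 0.
Proof.
move=> two [i [j [k cijk]]]; rewrite scalar_of_structE.
have -> : sum3 (fun i j k => c i j k * c i k j) = 0.
  by rewrite /sum3 big1 // => i' _; rewrite big1.
have T0 : 0 <= \sum_m (\sum_i c m i i) ^+ 2 by apply: sumr_ge0 => m _; exact: sqr_ge0.
have : 0 < sum3 (fun i j k => c i j k ^+ 2); last by lra.
have q0 a b d : 0 <= c a b d ^+ 2 := sqr_ge0 _.
rewrite /sum3 (bigD1 i) //= ltr_pwDl //; last first.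
  by apply: sumr_ge0 => ? _; apply: sumr_ge0 => ? _; exact: sumr_ge0.
rewrite (bigD1 j) //= ltr_pwDl //; last first.
  by apply: sumr_ge0 => ? _; exact: sumr_ge0.
rewrite (bigD1 k) //= ltr_pwDl //; last exact: sumr_ge0.
by rewrite exprn_even_gt0.
Qed.
End Antisymmetric.
End StructureConstants.

(** * Uniqueness of the Levi-Civita connection *)

Section KoszulFormula.
Context (R : realType) (n : nat) (M : topologicalType)
  (A : smoothStructure R n M) (g : riemannianMetric A).
Implicit Types (X Y Z : vfield A) (p : M) (nabla : vfield A -> vfield A -> vfield A).

Local Notation sv := (smooth_vfield (A := A) setT).
Local Notation gf Y Z := (fun q => g q (Y q) (Z q)).

(** Add the compatibility with the metric for X and Y, subtract it for Z, and
    exchange arguments of nabla by means of the torsion. *)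
Lemma koszul_formula nabla X Y Z p : levi_civita g nabla -> sv X -> sv Y -> sv Z ->
  2 * g p (nabla X Y p) (Z p) =
  lie_deriv X (gf Y Z) p + lie_deriv Y (gf Z X) p - lie_deriv Z (gf X Y) p
  + g p (lie_bracket Z X p) (Y p) + g p (lie_bracket X Y p) (Z p)
  - g p (lie_bracket Y Z p) (X p).
Proof.
move=> lc sX sY sZ.
rewrite !(nabla_metric lc) // -!(nabla_torsion_free lc) // /vfield_sub !metricBl.
rewrite (Defs.metric_sym g p (Y p)) (Defs.metric_sym g p (X p)).
rewrite (Defs.metric_sym g p (Z p)).
ring.
Qed.

Lemma levi_civita_unique nabla nabla' (e : 'I_n -> vfield A) X Y :
  (forall i, sv (e i)) -> (forall p, orthonormal_at g p (e^~ p)) ->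
  levi_civita g nabla -> levi_civita g nabla' -> sv X -> sv Y ->
  nabla X Y = nabla' X Y.
Proof.
move=> se oe lc lc' sX sY; apply/funext => p.
rewrite (orthonormal_expand (nabla X Y p) (oe p)).
rewrite (orthonormal_expand (nabla' X Y p) (oe p)); apply: eq_bigr => i _.
congr (_ *: _); apply: (@mulfI _ 2); first by rewrite pnatr_eq0.
by rewrite !(koszul_formula p _ sX sY (se i)).
Qed.
End KoszulFormula.

(** * Connection and curvature in an orthonormal frame *)

Section Frame.
Context (R : realType) (n : nat) (M : topologicalType)
  (A : smoothStructure R n M) (g : riemannianMetric A).
Variables (E : 'I_n -> vfield A) (c : 'I_n -> 'I_n -> 'I_n -> R).

Local Notation sv := (smooth_vfield (A := A) setT).

Hypothesis sE : forall i, sv (E i).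
Hypothesis oE : forall p, orthonormal_at g p (E^~ p).
Hypothesis cE : forall i j k p, g p (lie_bracket (E i) (E j) p) (E k p) = c i j k.

Implicit Types (X Y Z : vfield A) (p : M) (f : M -> R) (x y z : 'I_n -> R).

Definition frame_coord X k : M -> R := fun p => g p (X p) (E k p).

Lemma frame_expand X p : X p = \sum_k frame_coord X k p *: E k p.
Proof. exact: orthonormal_expand. Qed.

Lemma frame_coord_inj X Y p :
  (forall k, frame_coord X k p = frame_coord Y k p) -> X p = Y p.
Proof. by move=> XY; rewrite !frame_expand; apply: eq_bigr => k _; rewrite XY. Qed.

Lemma frame_coord_comb (a : 'I_n -> M -> R) k p :
  frame_coord (fun q => \sum_i a i q *: E i q) k p = a k p.
Proof. by rewrite /frame_coord (orthonormal_comb (fun i => a i p)). Qed.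

Lemma metric_frame_coord p u v :
  g p u v = \sum_k g p u (E k p) * g p v (E k p).
Proof.
rewrite {1}(orthonormal_expand u (oE p)) metric_suml; apply: eq_bigr => k _.
by rewrite metricZl (Defs.metric_sym g p (E k p)).
Qed.

Lemma smooth_frame_coord X k p : sv X -> smooth_near A (frame_coord X k) p.
Proof. by move=> sX; exact: smooth_near_metric. Qed.

Lemma lie_deriv_frame X f p :
  lie_deriv X f p = \sum_i frame_coord X i p * lie_deriv (E i) f p.
Proof.
rewrite /lie_deriv {1}frame_expand deriv_along_sum.
by apply: eq_bigr => i _; rewrite deriv_alongZ.
Qed.

Lemma struct_antisym p i j k : c i j k = - c j i k.
Proof.
rewrite -(cE i j k p) -(cE j i k p) -metricNl; congr (g p _ _).
by apply/rowP => l; rewrite !mxE opprB.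
Qed.

Local Notation Gam := (christoffel c).
Local Notation coords X p := (frame_coord X ^~ p).

Lemma lie_deriv_contract t X Y Z k p : sv Y -> sv Z ->
  lie_deriv X (fun q => contract t (coords Y q) (coords Z q) k) p =
  contract t (fun i => lie_deriv X (frame_coord Y i) p) (coords Z p) k +
  contract t (coords Y p) (fun i => lie_deriv X (frame_coord Z i) p) k.
Proof.
move=> sY sZ; have sy i := smooth_frame_coord i p sY.
have sz i := smooth_frame_coord i p sZ.
have syz i j :=
  smooth_nearM (smooth_nearM (sy i) (sz j)) (smooth_near_cst A (t i j k) p).
rewrite lie_deriv_sumf => [|i]; last exact: smooth_near_sum.
rewrite -big_split; apply: eq_bigr => i _ /=.
rewrite lie_deriv_sumf // -big_split; apply: eq_bigr => j _ /=.
rewrite (lie_derivM X (smooth_nearM (sy i) (sz j)) (smooth_near_cst A (t i j k) p)).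
by rewrite (lie_derivM X (sy i) (sz j)) lie_deriv_cst mulr0 addr0 mulrDl.
Qed.

Lemma smooth_near_contract t Y Z k p : sv Y -> sv Z ->
  smooth_near A (fun q => contract t (coords Y q) (coords Z q) k) p.
Proof.
move=> sY sZ; apply: smooth_near_sum => i; apply: smooth_near_sum => j.
apply: smooth_nearM; last exact: smooth_near_cst.
by apply: smooth_nearM; exact: smooth_frame_coord.
Qed.

(** As in [lie_deriv2_partial], with the frame in place of the coordinate fields.
    The frame fields do not commute, and their brackets contribute the structure
    constants to [frame_coord_bracket]. *)
Lemma lie_deriv2_frame X Y f p : sv Y -> smooth_near A f p ->
  lie_deriv X (lie_deriv Y f) p =
    \sum_j lie_deriv X (frame_coord Y j) p * lie_deriv (E j) f p
    + \sum_i \sum_j frame_coord X i p * frame_coord Y j p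
      * lie_deriv (E i) (lie_deriv (E j) f) p.
Proof.
move=> sY sf; have sy i := smooth_frame_coord i p sY.
have sEf j := smooth_near_lie (sE j) sf.
rewrite (_ : lie_deriv Y f = fun q => \sum_j frame_coord Y j q * lie_deriv (E j) f q).
  rewrite lie_deriv_sumf => [|j]; last exact: smooth_nearM.
  rewrite exchange_big -big_split; apply: eq_bigr => j _ /=.
  rewrite lie_derivM //; congr (_ + _).
  rewrite lie_deriv_frame mulr_sumr; apply: eq_bigr => i _; ring.
by apply/funext => q; exact: lie_deriv_frame.
Qed.

Lemma frame_coord_bracket X Y k p : sv X -> sv Y ->
  frame_coord (lie_bracket X Y) k p =
  lie_deriv X (frame_coord Y k) p - lie_deriv Y (frame_coord X k) p
    + contract c (coords X p) (coords Y p) k.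
Proof.
move=> sX sY.
have -> : frame_coord (lie_bracket X Y) k p =
  g p (\sum_j (lie_deriv X (frame_coord Y j) p - lie_deriv Y (frame_coord X j) p)
    *: E j p
    + \sum_i \sum_j (frame_coord X i p * frame_coord Y j p)
      *: lie_bracket (E i) (E j) p) (E k p).
  congr (g p _ _); apply: (@deriv_along_inj _ _ _ A p) => f sf.
  rewrite -[LHS]/(lie_deriv (lie_bracket X Y) f p) lie_bracketE //.
  rewrite !lie_deriv2_frame // deriv_alongD !deriv_along_sum.
  rewrite [X in _ - (_ + X)]exchange_big /= opprD addrACA -!sumrB.
  congr (_ + _); apply: eq_bigr => i _.
    by rewrite deriv_alongZ mulrBl.
  rewrite deriv_along_sum -sumrB; apply: eq_bigr => j _.
  rewrite deriv_alongZ -[deriv_along A f p _]/(lie_deriv (lie_bracket (E i) (E j)) f p).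
  by rewrite lie_bracketE // mulrBr [X in _ - X * _]mulrC.
rewrite metricDl (orthonormal_comb
  (fun j => lie_deriv X (frame_coord Y j) p - lie_deriv Y (frame_coord X j) p)) //.
congr (_ + _); rewrite metric_suml; apply: eq_bigr => i _.
rewrite metric_suml; apply: eq_bigr => j _.
by rewrite metricZl cE.
Qed.

Definition frame_nabla X Y : vfield A := fun p =>
  \sum_k (lie_deriv X (frame_coord Y k) p + contract Gam (coords X p) (coords Y p) k)
    *: E k p.

Lemma frame_coord_nabla X Y k p :
  frame_coord (frame_nabla X Y) k p = lie_deriv X (frame_coord Y k) p
    + contract Gam (coords X p) (coords Y p) k.
Proof.
exact: (frame_coord_comb (fun k q =>
  lie_deriv X (frame_coord Y k) q + contract Gam (coords X q) (coords Y q) k)).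
Qed.

Lemma frame_coord_add X Y k :
  frame_coord (vfield_add X Y) k = fun p => frame_coord X k p + frame_coord Y k p.
Proof. by apply/funext => p; exact: metricDl. Qed.

Lemma frame_coord_sub X Y k :
  frame_coord (vfield_sub X Y) k = fun p => frame_coord X k p - frame_coord Y k p.
Proof. by apply/funext => p; exact: metricBl. Qed.

Lemma frame_coord_scale f X k :
  frame_coord (vfield_scale f X) k = fun p => f p * frame_coord X k p.
Proof. by apply/funext => p; exact: metricZl. Qed.

Lemma smooth_frame_nabla X Y : sv X -> sv Y -> sv (frame_nabla X Y).
Proof.
move=> sX sY; apply: smooth_vfield_sum => // k p; apply: smooth_nearD.
  by apply: smooth_near_lie => //; exact: smooth_frame_coord.
exact: smooth_near_contract.
Qed.

(** Every axiom is checked on frame coordinates; the torsion and the metric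
    axioms come down to the two identities of the Christoffel symbols. *)
Lemma frame_nabla_levi_civita : levi_civita g frame_nabla.
Proof.
split.
- exact: smooth_frame_nabla.
- move=> X Y Z sX sY sZ; apply/funext => p; apply: frame_coord_inj => k.
  rewrite frame_coord_nabla frame_coord_add !frame_coord_nabla /lie_deriv deriv_alongD.
  rewrite (_ : (coords (vfield_add X Y) p) = fun i => frame_coord X i p
    + frame_coord Y i p); last first.
    by apply/funext => i; rewrite frame_coord_add.
  by rewrite contractDl addrACA.
- move=> f X Y sf sX sY; apply/funext => p; apply: frame_coord_inj => k.
  rewrite frame_coord_nabla frame_coord_scale !frame_coord_nabla /lie_deriv
    deriv_alongZ.
  rewrite (_ : (coords (vfield_scale f X) p) = fun i => f p * frame_coord X i p);
    last first.
    by apply/funext => i; rewrite frame_coord_scale.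
  by rewrite contractZl mulrDr.
- move=> X Y Z sX sY sZ; apply/funext => p; apply: frame_coord_inj => k.
  rewrite frame_coord_nabla !frame_coord_add !frame_coord_nabla.
  rewrite lie_derivD; [|exact: smooth_frame_coord|exact: smooth_frame_coord].
  rewrite (_ : (coords (vfield_add Y Z) p) = fun i => frame_coord Y i p
    + frame_coord Z i p); last first.
    by apply/funext => i; rewrite frame_coord_add.
  by rewrite contractDr addrACA.
- move=> f X Y sf sX sY; apply/funext => p; apply: frame_coord_inj => k.
  rewrite frame_coord_nabla frame_coord_add !frame_coord_scale frame_coord_nabla.
  rewrite lie_derivM; [|exact: smooth_fun_near|exact: smooth_frame_coord].
  rewrite (_ : (coords (vfield_scale f Y) p) = fun i => f p * frame_coord Y i p);
    last first.
    by apply/funext => i; rewrite frame_coord_scale.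
  by rewrite contractZr mulrDr addrA.
- move=> X Y sX sY; apply/funext => p; apply: frame_coord_inj => k.
  rewrite frame_coord_sub !frame_coord_nabla frame_coord_bracket // opprD addrACA;
    congr (_ + _).
  rewrite /contract [X in _ - X]exchange_big -sumrB; apply: eq_bigr => i _ /=.
  rewrite -sumrB; apply: eq_bigr => j _.
  by rewrite -(christoffel_torsion (struct_antisym p)); ring.
- move=> X Y Z sX sY sZ p.
  have sy i := smooth_frame_coord i p sY; have sz i := smooth_frame_coord i p sZ.
  rewrite (_ : (fun q => g q (Y q) (Z q)) = fun q => \sum_k frame_coord Y k q
    * frame_coord Z k q); last first.
    by apply/funext => q; exact: metric_frame_coord.
  rewrite lie_deriv_sumf => [|i]; last exact: smooth_nearM.
  rewrite !metric_frame_coord -big_split /=.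
  rewrite (eq_bigr (fun k => lie_deriv X (frame_coord Y k) p * frame_coord Z k p
     + frame_coord Y k p * lie_deriv X (frame_coord Z k) p)); last first.
    by move=> k _; rewrite lie_derivM.
  transitivity (\sum_k (lie_deriv X (frame_coord Y k) p * frame_coord Z k p
     + frame_coord Y k p * lie_deriv X (frame_coord Z k) p) +
     \sum_k (contract Gam (coords X p) (coords Y p) k * frame_coord Z k p
       + frame_coord Y k p * contract Gam (coords X p) (coords Z p) k)).
    rewrite -[LHS]addr0; congr (_ + _); apply/esym.
    rewrite big_split /=.
    rewrite (eq_bigr (fun k => \sum_i \sum_j frame_coord X i p * (frame_coord Y j p
      * frame_coord Z k p) * christoffel c i j k)); last first.
      move=> k _; rewrite mulr_suml; apply: eq_bigr => i _; rewrite mulr_suml.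
      by apply: eq_bigr => j _; ring.
    rewrite exchange_big [X in _ + X](eq_bigr (fun k => \sum_i \sum_j frame_coord X i p
      * (frame_coord Y k p * frame_coord Z j p) * christoffel c i j k)); last first.
      move=> k _; rewrite mulr_sumr; apply: eq_bigr => i _; rewrite mulr_sumr.
      by apply: eq_bigr => j _; ring.
    rewrite [X in _ + X]exchange_big -big_split /= big1 // => i _.
    rewrite [X in _ + X]exchange_big -big_split /= big1 // => k _.
    rewrite -big_split /= big1 // => j _.
    by rewrite -mulrDr addrC (christoffel_metric (struct_antisym p)) mulr0.
  rewrite -big_split; apply: eq_bigr => k _ /=.
  rewrite -[g p (frame_nabla X Y p) _]/(frame_coord (frame_nabla X Y) k p).
  rewrite -[g p (frame_nabla X Z p) _]/(frame_coord (frame_nabla X Z) k p).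
  rewrite !frame_coord_nabla -/(frame_coord Y k p) -/(frame_coord Z k p).
  by rewrite mulrDl mulrDr addrACA.
Qed.

(** All terms with derivatives of the coordinates cancel: the second derivatives
    of Z by [lie_bracketE], the first derivatives of X and Y against those in the
    coordinates of [X, Y], and the first derivatives of Z in pairs.  This is the
    tensoriality of the curvature. *)
Lemma frame_coord_curvature X Y Z k p : sv X -> sv Y -> sv Z ->
  frame_coord (curvature frame_nabla X Y Z) k p
    = riemann_form c (coords X p) (coords Y p) (coords Z p) k.
Proof.
move=> sX sY sZ; rewrite /curvature !frame_coord_sub.
have E2 V W : sv V -> sv W -> frame_coord (frame_nabla V (frame_nabla W Z)) k p =
  lie_deriv V (lie_deriv W (frame_coord Z k)) p
  + (contract Gam (fun i => lie_deriv V (frame_coord W i) p) (coords Z p) k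
     + contract Gam (coords W p) (fun i => lie_deriv V (frame_coord Z i) p) k)
  + (contract Gam (coords V p) (fun i => lie_deriv W (frame_coord Z i) p) k
     + contract Gam (coords V p) (contract Gam (coords W p) (coords Z p)) k).
  move=> sV sW; rewrite frame_coord_nabla -contractDr.
  rewrite (_ : frame_coord (frame_nabla W Z) k =
    fun q => lie_deriv W (frame_coord Z k) q
      + contract Gam (coords W q) (coords Z q) k); last first.
    by apply/funext => q; exact: frame_coord_nabla.
  rewrite (_ : coords (frame_nabla W Z) p =
    fun i => lie_deriv W (frame_coord Z i) p
      + contract Gam (coords W p) (coords Z p) i); last first.
    by apply/funext => q; exact: frame_coord_nabla.
  rewrite lie_derivD ?lie_deriv_contract //.
    by apply: smooth_near_lie => //; exact: smooth_frame_coord.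
  exact: smooth_near_contract.
rewrite !E2 // frame_coord_nabla lie_bracketE //; last exact: smooth_frame_coord.
rewrite (_ : coords (lie_bracket X Y) p =
  fun i => (lie_deriv X (frame_coord Y i) p - lie_deriv Y (frame_coord X i) p)
    + contract c (coords X p) (coords Y p) i); last first.
  by apply/funext => i; exact: frame_coord_bracket.
rewrite contractDl contractBl /riemann_form; ring.
Qed.

(** Existence and uniqueness of the trace at once.  Any orthonormal basis at p has
    an orthogonal matrix B of frame coordinates, and any Levi-Civita
    connection is the explicit one on smooth fields. *)
Lemma frame_scalar_curvature p s : is_scalar_curvature g p s <-> s = scalar_of_struct c.
Proof.
have tr (F : 'I_n -> vfield A) nabla : levi_civita g nabla -> (forall i, sv (F i)) ->
    orthonormal_at g p (F^~ p) ->
    \sum_i \sum_j g p (curvature nabla (F i) (F j) (F j) p) (F i p)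
      = scalar_of_struct c.
  move=> lc sF oF; pose B : 'M[R]_n := \matrix_(i, k) frame_coord (F i) k p.
  have BE i : coords (F i) p = B i by apply/funext => k; rewrite mxE.
  have BB : B *m B^T = 1%:M.
    apply/matrixP => i j; rewrite !mxE -(oF i j) metric_frame_coord.
    by apply: eq_bigr => k _; rewrite !mxE.
  have nablaE X Y : sv X -> sv Y -> nabla X Y = frame_nabla X Y.
    exact: levi_civita_unique sE oE lc frame_nabla_levi_civita.
  rewrite -(trace_frame_independent c BB); apply: eq_bigr => i _; apply: eq_bigr => j _.
  have -> : curvature nabla (F i) (F j) (F j) = curvature frame_nabla (F i) (F j) (F j).
    have sFF k l : sv (frame_nabla (F k) (F l)) by exact: smooth_frame_nabla.
    have sb := smooth_lie_bracket (sF i) (sF j).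
    by rewrite /curvature !nablaE.
  rewrite metric_frame_coord; apply: eq_bigr => k _.
  by rewrite -!BE -frame_coord_curvature.
split=> [[nabla [F [lc sF oF ->]]]|->]; first exact: tr.
exists frame_nabla, E; split=> //; first exact: frame_nabla_levi_civita.
- exact: oE.
- by rewrite tr //; exact: frame_nabla_levi_civita.
Qed.

Lemma frame_scalar_curvatureE p : scalar_curvature g p = scalar_of_struct c.
Proof.
have H : is_scalar_curvature g p (scalar_of_struct c) by apply/frame_scalar_curvature.
apply/(frame_scalar_curvature p); rewrite /scalar_curvature.
exact: (xgetPex 0 (ex_intro _ _ H)).
Qed.

End Frame.

(** * The left invariant frame of a nilpotent group *)

Section LeftInvariantFrame.
Context (R : realType) (n : nat) (N : topologicalGroupType)
  (A : smoothStructure R n N) (g : riemannianMetric A).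
Hypotheses (hlie : lie_group A) (hg : left_invariant_metric g).
Implicit Types (X Y : vfield A) (p : N).

Local Notation sv := (smooth_vfield (A := A) setT).

Lemma left_invariant_inner X Y p : left_invariant X -> left_invariant Y ->
  g p (X p) (Y p) = g 1%g (X 1%g) (Y 1%g).
Proof. by move=> lX lY; have := hg p 1%g (X 1%g) (Y 1%g); rewrite -lX -lY mulg1. Qed.

Lemma orthonormal_invariant_frame : exists E : 'I_n -> vfield A,
  [/\ forall i, sv (E i), forall i, left_invariant (E i) &
      forall p, orthonormal_at g p (E^~ p)].
Proof.
have [e oe] := orthonormal_sub g 1%g (leqnn n).
exists (fun i => invariant_field A (e i)); split=> [i|i|p i j].
- exact: smooth_invariant_field.
- exact: left_invariant_field.
by have := hg p 1%g (e i) (e j); rewrite mulg1 oe.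
Qed.

(** Left invariant fields have constant frame coordinates, so their brackets are
    given by the structure constants alone: [X, Y] <> 0 forces some c_ijk <> 0, and
    [E_i, [E_i, E_j]] = 0 is the quadratic relation for the sign. *)
Lemma nilpotent_scalar_curvature : two_step_nilpotent A ->
  exists2 s : R, s < 0 & forall p, scalar_curvature g p = s.
Proof.
move=> [[X [Y [[sX lX] [sY lY] XY]]] two].
have [E [sE lE oE]] := orthonormal_invariant_frame.
have aE i : lie_algebra (E i) by split; [exact: sE|exact: lE].
have lEE i j : left_invariant (lie_bracket (E i) (E j))
  by exact: left_invariant_bracket.
pose c i j k := g 1%g (lie_bracket (E i) (E j) 1%g) (E k 1%g).
have cE i j k p : g p (lie_bracket (E i) (E j) p) (E k p) = c i j k.
  exact: left_invariant_inner.
have coord_const Z k : left_invariant Z -> frame_coord g E Z k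
  = fun=> frame_coord g E Z k 1%g.
  by move=> lZ; apply/funext => p; exact: left_invariant_inner.
exists (scalar_of_struct c); last exact: (frame_scalar_curvatureE sE oE cE).
apply: (scalar_of_struct_lt0 (struct_antisym cE 1%g)) => [i j k|].
  have sEE := smooth_lie_bracket (sE i) (sE j).
  have := frame_coord_bracket sE oE cE k 1%g (sE i) sEE.
  rewrite (coord_const _ _ (lE i)) (coord_const _ _ (lEE i j)) !lie_deriv_cst subrr
    add0r.
  rewrite /frame_coord (two _ _ _ (aE i) (aE i) (aE j)) metric0l => bracket0.
  rewrite [RHS]bracket0 /contract exchange_big /=; apply: eq_bigr => l _.
  by rewrite cE; under [RHS]eq_bigr do rewrite oE -mulrA; rewrite sum_delta.
apply: contrapT => c0; apply: XY; apply/funext => p.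
(* The coordinates of X and Y are constant, so only the structure constants
   contribute to [X, Y]. *)
have c0' i j k : c i j k = 0.
  by apply/eqP; apply: contrapT => /negP cijk; apply: c0; exists i, j, k.
apply: (frame_coord_inj oE (X := lie_bracket X Y) (Y := fun=> 0)) => k.
rewrite (frame_coord_bracket sE oE cE k p sX sY) (coord_const _ _ lX)
  (coord_const _ _ lY).
rewrite !lie_deriv_cst subrr add0r [RHS]metric0l /contract.
by rewrite big1 // => i _; rewrite big1 // => j _; rewrite c0' mulr0.
Qed.
End LeftInvariantFrame.

Theorem mainTheorem1 (R : realType) (N : topologicalGroupType)
  (A : smoothStructure R 5 N) (hlie : lie_group A)
  (hsc : simply_connected R N) (hnil : two_step_nilpotent A)
  (g : riemannianMetric A) (hg : left_invariant_metric g) :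
  exists2 c : R, c < 0 & forall p : N, scalar_curvature g p = c.
Proof. exact: nilpotent_scalar_curvature. Qed.
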